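(* Let $(\mathcal{L}_1,\circ^1_\lambda,[\cdot_\lambda\cdot]^1)$ and $(\mathcal{L}_2,\circ^2_\lambda,[\cdot_\lambda\cdot]^2)$ be two transposed Poisson conformal superalgebras (TPCSAs). Set $\mathcal{L}:=\mathcal{L}_1\otimes_{\mathbb{C}[\partial]}\mathcal{L}_2$, graded by $|a\otimes b|=|a|+|b|$, with $\mathbb{C}[\partial]$-module structure $\partial(a\otimes b):=(\partial a)\otimes b=a\otimes(\partial b)$ for $a\in\mathcal{L}_1$, $b\in\mathcal{L}_2$. Define a $\lambda$-product and a $\lambda$-bracket on $\mathcal{L}$ by $$(a_1\otimes a_2)\circ_\lambda(b_1\otimes b_2)=(-1)^{|a_2||b_1|}(a_1\circ^1_\lambda b_1)\otimes(a_2\circ^2_\lambda b_2),$$ $$[(a_1\otimes a_2)_\lambda(b_1\otimes b_2)]=(-1)^{|a_2||b_1|}\big([{a_1}_\lambda b_1]^1\otimes(a_2\circ^2_\lambda b_2)+(a_1\circ^1_\lambda b_1)\otimes[{a_2}_\lambda b_2]^2\big),$$ for all $a_1,b_1\in\mathcal{L}_1$, $a_2,b_2\in\mathcal{L}_2$. Then $(\mathcal{L},\circ_\lambda,[\cdot_\lambda\cdot])$ is a TPCSA.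
   Context: All vector spaces and linear maps are over $\mathbb{C}$. A $\mathbb{Z}_2$-graded $\mathbb{C}[\partial]$-module is a $\mathbb{C}[\partial]$-module $A=A_{\bar0}\oplus A_{\bar1}$ with $\partial A_i\subseteq A_i$; $|a|$ denotes the parity of a homogeneous element $a$. Whenever $|a|$ occurs, $a$ is assumed homogeneous, and the formula is extended by linearity. $A[\lambda]$ denotes polynomials in $\lambda$ with coefficients in $A$. In the formulas for $\mathcal{L}$, the tensor of two polynomials in $\lambda$ is their product: $(\sum\lambda^mu_m)\otimes(\sum\lambda^nv_n)=\sum\lambda^{m+n}u_m\otimes v_n$. A conformal superalgebra $(A,\circ_\lambda)$ is a $\mathbb{Z}_2$-graded $\mathbb{C}[\partial]$-module $A$ with a $\mathbb{C}$-bilinear map $A\otimes A\to A[\lambda]$, $a\otimes b\mapsto a\circ_\lambda b$, with $A_i\circ_\lambda A_j\subseteq A_{i+j}[\lambda]$, satisfying sesquilinearity: $(\partial a)\circ_\lambda b=-\lambda\, a\circ_\lambda b$, $a\circ_\lambda(\partial b)=(\partial+\lambda)(a\circ_\lambda b)$. Substitution convention: if $a\circ_\lambda b=\sum_n\lambda^n c_n$, then $a\circ_{-\partial-\lambda}b=\sum_n(-\partial-\lambda)^nc_n$ with $\partial$ acting on the coefficients $c_n$, and similarly for brackets. It is commutative if $a\circ_\lambda b=(-1)^{|a||b|}b\circ_{-\partial-\lambda}a$, and associative if $a\circ_\lambda(b\circ_\mu c)=(a\circ_\lambda b)\circ_{\lambda+\mu}c$, for all $a,b,c$. A Lie conformal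 superalgebra $(A,[\cdot_\lambda\cdot])$ is a $\mathbb{Z}_2$-graded $\mathbb{C}[\partial]$-module with a $\mathbb{C}$-bilinear map $a\otimes b\mapsto[a_\lambda b]\in A[\lambda]$, $[{A_i}_\lambda A_j]\subseteq A_{i+j}[\lambda]$, such that $[(\partial a)_\lambda b]=-\lambda[a_\lambda b]$, $[a_\lambda(\partial b)]=(\partial+\lambda)[a_\lambda b]$, $[a_\lambda b]=-(-1)^{|a||b|}[b_{-\lambda-\partial}a]$, and $[a_\lambda[b_\mu c]]=[[a_\lambda b]_{\lambda+\mu}c]+(-1)^{|a||b|}[b_\mu[a_\lambda c]]$. A transposed Poisson conformal superalgebra (TPCSA) is a $\mathbb{Z}_2$-graded $\mathbb{C}[\partial]$-module $\mathcal{L}$ with $\circ_\lambda$ and $[\cdot_\lambda\cdot]$ such that $(\mathcal{L},\circ_\lambda)$ is a commutative associative conformal superalgebra, $(\mathcal{L},[\cdot_\lambda\cdot])$ is a Lie conformal superalgebra, and $2(a\circ_\lambda[b_\mu c])=[(a\circ_\lambda b)_{\lambda+\mu}c]+(-1)^{|a||b|}[b_\mu(a\circ_\lambda c)]$ for all $a,b,c\in\mathcal{L}$. *)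

(* Defs.v *)
From HB Require Import structures.
From mathcomp Require Import all_boot all_order all_algebra.
From mathcomp Require Import boolp reals.
From mathcomp Require Import finmap.
From mathcomp.multinomials Require Import monalg.
From mathcomp.real_closed Require Import complex.

Set Implicit Arguments.
Unset Strict Implicit.
Unset Printing Implicit Defensive.

Import GRing.Theory.
Local Open Scope ring_scope.

Inductive span (P : pzRingType) (V : lmodType P) (S : V -> Prop) : V -> Prop :=
| span_zero : span S 0
| span_comb (c : P) (x y : V) : S x -> span S y -> span S (c *: x + y).

Section Tensor.
Variables (P : comNzRingType) (M N : lmodType P).

(* The free P-module with basis M * N; the basis vector at (m, n) is << (m, n) >>. *)
Definition free_mod := {malg P[(M * N)%type]}.

Inductive tensor_gen : free_mod -> Prop :=
| tgen_addl m m' n : tensor_gen (<< (m + m', n) >> - << (m, n) >> - << (m', n) >>)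
| tgen_addr m n n' : tensor_gen (<< (m, n + n') >> - << (m, n) >> - << (m, n') >>)
| tgen_scalel c m n : tensor_gen (<< (c *: m, n) >> - c *: << (m, n) >>)
| tgen_scaler c m n : tensor_gen (<< (m, c *: n) >> - c *: << (m, n) >>).

Definition tensor_rel : {pred free_mod} := fun x => `[< span tensor_gen x >].

Lemma tensor_relP x : reflect (span tensor_gen x) (x \in tensor_rel).
Proof. exact: asboolP. Qed.

Lemma tensor_rel_submod_closed : submod_closed tensor_rel.
Proof.
split=> [|c x y /tensor_relP sx /tensor_relP sy]; apply/tensor_relP.
  exact: span_zero.
elim: sx => [|d z w Sz _ IH]; first by rewrite scaler0 add0r.
by rewrite scalerDr scalerA -addrA; apply: span_comb.
Qed.

HB.instance Definition _ :=
  GRing.isSubmodClosed.Build P free_mod tensor_rel tensor_rel_submod_closed.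

Definition tensor := Quotient.quot tensor_rel.

HB.instance Definition _ := GRing.Zmodule.on tensor.

Definition tensor_pi (x : free_mod) : tensor := \pi_(Quotient.quot tensor_rel)%qT x.

Definition tensor_scale (c : P) (t : tensor) : tensor :=
  tensor_pi (c *: (repr (t : Quotient.quot tensor_rel))).

Lemma tensor_piP x y : tensor_pi x = tensor_pi y <-> x - y \in tensor_rel.
Proof.
rewrite /tensor_pi; split=> [/eqP|] h; first by rewrite Quotient.idealrBE.
by apply/eqP; rewrite -Quotient.idealrBE.
Qed.

Lemma tensor_piD x y : tensor_pi (x + y) = tensor_pi x + tensor_pi y.
Proof. exact: (@raddfD _ (Quotient.quot tensor_rel) \pi_(Quotient.quot tensor_rel)%qT). Qed.

Lemma tensor_piK (t : tensor) : tensor_pi (repr (t : Quotient.quot tensor_rel)) = t.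
Proof. exact: reprK. Qed.

Lemma tensor_piZ c x : tensor_pi (c *: x) = tensor_scale c (tensor_pi x).
Proof.
apply/tensor_piP; rewrite -scalerBr; apply: rpredZ.
by apply/tensor_piP; rewrite tensor_piK.
Qed.

Fact tensor_scaleA a b t :
  tensor_scale a (tensor_scale b t) = tensor_scale (a * b) t.
Proof. by rewrite -[t]tensor_piK -!tensor_piZ scalerA. Qed.

Fact tensor_scale1 : left_id 1 tensor_scale.
Proof. by move=> t; rewrite -[t]tensor_piK -!tensor_piZ scale1r. Qed.

Fact tensor_scaleDr : right_distributive tensor_scale +%R.
Proof.
move=> c s t; rewrite -[s]tensor_piK -[t]tensor_piK.
by rewrite -tensor_piD -!tensor_piZ scalerDr tensor_piD.
Qed.

Fact tensor_scaleDl t : {morph tensor_scale^~ t : a b / a + b}.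
Proof.
by move=> a b; rewrite -[t]tensor_piK -!tensor_piZ scalerDl tensor_piD.
Qed.

HB.instance Definition _ := GRing.Zmodule_isLmodule.Build P tensor
  tensor_scaleA tensor_scale1 tensor_scaleDr tensor_scaleDl.

Definition tens (m : M) (n : N) : tensor := tensor_pi << (m, n) >>.

Lemma tensor_gen_eq x y z : tensor_gen (x - y - z) ->
  tensor_pi x = tensor_pi y + tensor_pi z.
Proof.
move=> h; rewrite -tensor_piD; apply/tensor_piP/tensor_relP.
rewrite opprD addrA -[X in span _ X]addr0 -[X in X + 0]scale1r.
by apply: span_comb => //; apply: span_zero.
Qed.

Lemma tensDl m m' n : tens (m + m') n = tens m n + tens m' n.
Proof. exact/tensor_gen_eq/tgen_addl. Qed.

Lemma tensDr m n n' : tens m (n + n') = tens m n + tens m n'.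
Proof. exact/tensor_gen_eq/tgen_addr. Qed.

Lemma tensZl c m n : tens (c *: m) n = c *: tens m n.
Proof.
rewrite -[RHS]tensor_piZ; apply/tensor_piP/tensor_relP.
rewrite -[X in span _ X]addr0 -[X in X + 0]scale1r.
by apply: span_comb; [apply: tgen_scalel|apply: span_zero].
Qed.

Lemma tensZr c m n : tens m (c *: n) = c *: tens m n.
Proof.
rewrite -[RHS]tensor_piZ; apply/tensor_piP/tensor_relP.
rewrite -[X in span _ X]addr0 -[X in X + 0]scale1r.
by apply: span_comb; [apply: tgen_scaler|apply: span_zero].
Qed.

End Tensor.

(* {malg A[E]} is the group of finitely supported families of elements of A
   indexed by E; A[lambda] and A[lambda, mu] are indexed by exponents. *)
Notation lpoly A := {malg A[nat]}.
Notation lmpoly A := {malg A[(nat * nat)%type]}.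

Definition coef_map (E : choiceType) (A B : zmodType) (f : A -> B)
    (p : {malg A[E]}) : {malg B[E]} :=
  \sum_(k <- msupp p) << f p@_k *g k >>.

Definition exp_map (E E' : choiceType) (A : zmodType) (h : E -> E')
    (p : {malg A[E]}) : {malg A[E']} :=
  \sum_(k <- msupp p) << p@_k *g h k >>.

(* If p = \sum_n lambda^n c_n then subst_lam s f p = \sum_n s^n (f c_n). *)
Definition subst_lam (A V : zmodType) (s : V -> V) (f : A -> V)
    (p : lpoly A) : V :=
  \sum_(n <- msupp p) iter n s (f p@_n).

Section LambdaPoly.
Variable A : zmodType.

Definition const1 (a : A) : lpoly A := << a *g 0%N >>.
Definition const2 (a : A) : lmpoly A := << a *g (0%N, 0%N) >>.

(* Multiplication by lambda in A[lambda], by lambda, mu, lambda + mu in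
   A[lambda, mu]. *)
Definition mul_lam1 : lpoly A -> lpoly A := exp_map succn.
Definition mul_lam : lmpoly A -> lmpoly A := exp_map (fun e => (e.1.+1, e.2)).
Definition mul_mu : lmpoly A -> lmpoly A := exp_map (fun e => (e.1, e.2.+1)).
Definition mul_lam_mu (p : lmpoly A) : lmpoly A := mul_lam p + mul_mu p.

(* a op1_s (b op2_t c) and (a op1_s b) op2_t c, for s and t among lambda, mu
   and lambda + mu, the latter given by their action on A[lambda, mu]. *)
Definition nest_r (s t : lmpoly A -> lmpoly A) (op1 op2 : A -> A -> lpoly A)
    (a b c : A) : lmpoly A :=
  subst_lam t (fun d => subst_lam s const2 (op1 a d)) (op2 b c).

Definition nest_l (s t : lmpoly A -> lmpoly A) (op1 op2 : A -> A -> lpoly A)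
    (a b c : A) : lmpoly A :=
  subst_lam s (fun d => subst_lam t const2 (op2 d c)) (op1 a b).

End LambdaPoly.

(* (-1)^(i j) x *)
Definition ksign (V : zmodType) (i j : bool) (x : V) : V :=
  if i && j then - x else x.

(* A C[d]-module is a module over {poly C}, the indeterminate acting as d and
   the constants c%:P as the scalars. Parities are booleans, true being odd. *)
Section Conformal.
Variables (C : fieldType) (A : lmodType {poly C}).
Implicit Types (gr : bool -> A -> Prop) (op mul br : A -> A -> lpoly A).

Definition der (a : A) : A := 'X *: a.

Definition cscale (c : C) (p : lpoly A) : lpoly A := coef_map (fun a => c%:P *: a) p.

Record z2_graded gr : Prop := Z2Graded {
  gr_zero : forall i, gr i 0;
  gr_lin : forall i (c : C) a b, gr i a -> gr i b -> gr i (c%:P *: a + b);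
  gr_der : forall i a, gr i a -> gr i (der a);
  gr_sum : forall a, exists a0 a1, [/\ gr false a0, gr true a1 & a = a0 + a1];
  gr_direct : forall a, gr false a -> gr true a -> a = 0 }.

Definition c_bilinear op : Prop :=
  (forall (c : C) a a' b, op (c%:P *: a + a') b = cscale c (op a b) + op a' b) /\
  (forall (c : C) a b b', op a (c%:P *: b + b') = cscale c (op a b) + op a b').

(* a op_(-d-lambda) b *)
Definition op_opp op (a b : A) : lpoly A :=
  subst_lam (fun p => - coef_map der p - mul_lam1 p) (@const1 A) (op a b).

Record conformal_superalgebra gr op : Prop := ConformalSuperalgebra {
  cs_graded : z2_graded gr;
  cs_bilinear : c_bilinear op;
  cs_parity : forall i j a b, gr i a -> gr j b ->
    forall n, gr (i (+) j) (op a b)@_n;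
  cs_derl : forall a b, op (der a) b = - mul_lam1 (op a b);
  cs_derr : forall a b, op a (der b) = coef_map der (op a b) + mul_lam1 (op a b) }.

Definition conformal_commutative gr op : Prop :=
  forall i j a b, gr i a -> gr j b -> op a b = ksign i j (op_opp op b a).

Definition conformal_associative op : Prop :=
  forall a b c,
    nest_r (@mul_lam A) (@mul_mu A) op op a b c
    = nest_l (@mul_lam A) (@mul_lam_mu A) op op a b c.

Record lie_conformal_superalgebra gr br : Prop := LieConformalSuperalgebra {
  lcs_conformal : conformal_superalgebra gr br;
  lcs_skew : forall i j a b, gr i a -> gr j b ->
    br a b = - ksign i j (op_opp br b a);
  lcs_jacobi : forall i j a b c, gr i a -> gr j b ->
    nest_r (@mul_lam A) (@mul_mu A) br br a b c
    = nest_l (@mul_lam A) (@mul_lam_mu A) br br a b c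
      + ksign i j (nest_r (@mul_mu A) (@mul_lam A) br br b a c) }.

Record tpcsa gr mul br : Prop := TPCSA {
  tpcsa_conformal : conformal_superalgebra gr mul;
  tpcsa_commutative : conformal_commutative gr mul;
  tpcsa_associative : conformal_associative mul;
  tpcsa_lie : lie_conformal_superalgebra gr br;
  tpcsa_compat : forall i j a b c, gr i a -> gr j b ->
    nest_r (@mul_lam A) (@mul_mu A) mul br a b c *+ 2
    = nest_l (@mul_lam A) (@mul_lam_mu A) mul br a b c
      + ksign i j (nest_r (@mul_mu A) (@mul_lam A) br mul b a c) }.

End Conformal.

Section TensorConformal.
Variables (C : fieldType) (L1 L2 : lmodType {poly C}).
Variables (gr1 : bool -> L1 -> Prop) (gr2 : bool -> L2 -> Prop).
Variables (mul1 br1 : L1 -> L1 -> lpoly L1) (mul2 br2 : L2 -> L2 -> lpoly L2).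

Local Notation L := (tensor L1 L2).

Definition tensor_gr (i : bool) : L -> Prop :=
  span (fun t : L => exists j k a b,
    [/\ gr1 j a, gr2 k b, j (+) k = i & t = tens a b]).

Definition tens_lam (p : lpoly L1) (q : lpoly L2) : lpoly L :=
  \sum_(m <- msupp p) \sum_(n <- msupp q) << tens p@_m q@_n *g (m + n)%N >>.

Definition is_tensor_mul (mul : L -> L -> lpoly L) : Prop :=
  c_bilinear mul /\
  forall i j a1 a2 b1 b2, gr2 i a2 -> gr1 j b1 ->
    mul (tens a1 a2) (tens b1 b2)
    = ksign i j (tens_lam (mul1 a1 b1) (mul2 a2 b2)).

Definition is_tensor_br (br : L -> L -> lpoly L) : Prop :=
  c_bilinear br /\
  forall i j a1 a2 b1 b2, gr2 i a2 -> gr1 j b1 ->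
    br (tens a1 a2) (tens b1 b2)
    = ksign i j (tens_lam (br1 a1 b1) (mul2 a2 b2)
                 + tens_lam (mul1 a1 b1) (br2 a2 b2)).

End TensorConformal.

(* Main.v *)
(** Every operation of L1 (x) L2 is determined on homogeneous pure tensors, and
    on these the two sides of each axiom factor: a nested product of pure
    tensors is a Koszul sign times the tensor product, over polynomials in
    lambda and mu, of nested products in L1 and in L2. The only axiom that does
    not reduce at once to the same axioms of the factors is the Jacobi identity,
    because of the terms mixing both brackets. Those are handled by three
    consequences of the compatibility condition that express twice a.[b c],
    [a b].c and b.[a c] through [(a.b) c], [a (b.c)] and [b (a.c)]; with them
    twice the mixed terms cancel, and 2 is invertible. *)

Require Import Defs.
From mathcomp Require Import all_boot all_order all_algebra.
From mathcomp Require Import boolp reals.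
From mathcomp Require Import finmap.
From mathcomp.multinomials Require Import monalg.
From mathcomp.real_closed Require Import complex.

Set Implicit Arguments.
Unset Strict Implicit.
Unset Printing Implicit Defensive.

Import Defs GRing.Theory.
Local Open Scope ring_scope.

(** * Additive maps and polynomials in lambda *)

(** The products on the tensor product are prescribed on homogeneous pure tensors only, so their
    existence is itself a claim. The formula descends to a tensor product over C[d] because d acts
    by - lambda on the first arguments of both factors and by d + lambda on the second ones, and
    both d and lambda may be moved from one factor to the other. Of the three consequences of
    compatibility, those for a.[b c] and b.[a c] are compatibility itself and its form with a and b
    exchanged. The one for [a b].c requires the substitution of - d - lambda - mu for a variable,
    where d acts on coefficients; this is why substitution is by additive operators on A[lambda, mu]
    that commute with each other. In the Jacobi identity, a term with both brackets in one factor
    carries a triple product in the other. Associativity and commutativity identify these triple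
    products up to sign, so that they factor out and leave the Jacobi identity of a single
    factor. *)

Notation additive_map f := {morph f : x y / x + y}.

Section AdditiveMap.
Variables (U V : zmodType) (f : U -> V).
Hypothesis fD : additive_map f.

Lemma addm0 : f 0 = 0.
Proof. by apply: (addrI (f 0)); rewrite -fD !addr0. Qed.

Lemma addmN : {morph f : x / - x}.
Proof. by move=> x; apply: (addrI (f x)); rewrite -fD !subrr addm0. Qed.

Lemma addmB : {morph f : x y / x - y}.
Proof. by move=> x y; rewrite fD addmN. Qed.

Lemma addmMn n : {morph f : x / x *+ n}.
Proof. by move=> x; elim: n => [|n IH]; rewrite ?addm0 // !mulrS fD IH. Qed.

Lemma addm_sum I (r : seq I) F : f (\sum_(i <- r) F i) = \sum_(i <- r) f (F i).
Proof. exact: (big_morph f fD addm0). Qed.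

End AdditiveMap.

Lemma addm_iter (V : zmodType) (s : V -> V) n :
  additive_map s -> additive_map (iter n s).
Proof. by move=> sD x y; elim: n => //= n ->. Qed.

Lemma iter_comm (U V : Type) (g : U -> V) (s : U -> U) (s' : V -> V) n x :
  (forall y, g (s y) = s' (g y)) -> g (iter n s x) = iter n s' (g x).
Proof. by move=> gs; elim: n => //= n <-. Qed.

Definition sgn (V : zmodType) (b : bool) (x : V) : V := if b then - x else x.

Section Sgn.
Variable V : zmodType.
Implicit Types (x y : V) (b : bool).

Lemma ksignE i j x : ksign i j x = sgn (i && j) x.
Proof. by []. Qed.

Lemma sgnD b : additive_map (@sgn V b).
Proof. by case: b => x y //=; rewrite opprD. Qed.

Lemma sgnN b x : sgn b (- x) = - sgn b x.
Proof. by case: b. Qed.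

Lemma sgn_addb b c x : sgn b (sgn c x) = sgn (b (+) c) x.
Proof. by case: b c => [] [] //=; rewrite opprK. Qed.

Lemma sgnK b : involutive (@sgn V b).
Proof. by case: b => x //=; rewrite opprK. Qed.

Lemma sgnMn b x n : sgn b (x *+ n) = sgn b x *+ n.
Proof. by case: b; rewrite //= mulNrn. Qed.

End Sgn.

Lemma addm_sgn (U V : zmodType) (f : U -> V) b x :
  additive_map f -> f (sgn b x) = sgn b (f x).
Proof. by move=> fD; case: b => //=; rewrite addmN. Qed.

Section MalgSum.
Variables (E : choiceType) (A V : zmodType).

(** Sums over the supports of different elements have different ranges; a common larger range makes
    them comparable, since a zero coefficient contributes nothing. *)
Lemma malg_sumEw (F : E -> A -> V) (p : {malg A[E]}) (d : {fset E}) :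
  (forall k, F k 0 = 0) -> (msupp p `<=` d)%fset ->
  \sum_(k <- msupp p) F k p@_k = \sum_(k <- d) F k p@_k.
Proof.
move=> F0 le; apply: big_fset_incl => // k _ kp.
by rewrite mcoeff_outdom.
Qed.

(** Coefficient maps, exponent maps, substitutions, tensors of polynomials and lifts from the free
    module are all sums of this shape, so their additivity is obtained once and for all here. *)
Lemma malg_sumD (F : E -> A -> V) : (forall k, additive_map (F k)) ->
  additive_map (fun p : {malg A[E]} => \sum_(k <- msupp p) F k p@_k).
Proof.
move=> FD p q.
have F0 k : F k 0 = 0 by exact: addm0.
pose d := (msupp p `|` msupp q `|` msupp (p + q))%fset.
rewrite !(@malg_sumEw F _ d) ?fsubsetUr //.
- by rewrite -big_split; apply: eq_bigr => k _; rewrite mcoeffD FD.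
- by apply/fsubsetP => k; rewrite !inE => ->; rewrite orbT.
- by apply/fsubsetP => k; rewrite !inE => ->.
Qed.

Lemma malg_sumU (F : E -> A -> V) k a : (forall k, F k 0 = 0) ->
  \sum_(i <- msupp << a *g k >>) F i << a *g k >>@_i = F k a.
Proof.
move=> F0; rewrite (@malg_sumEw _ _ [fset k]%fset) ?msuppU_le //.
by rewrite big_seq_fset1 mcoeffUU.
Qed.

(** Monomials generate the group of polynomials, so an identity between additive maps need only be
    checked on them. *)
Lemma malg_ext (f g : {malg A[E]} -> V) : additive_map f -> additive_map g ->
  (forall k a, f << a *g k >> = g << a *g k >>) -> f =1 g.
Proof.
move=> fD gD fg p; rewrite (monalgE p) (addm_sum fD) (addm_sum gD).
by apply: eq_bigr.
Qed.

End MalgSum.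

Section CoefMap.
Variables (E : choiceType) (A B : zmodType).

Lemma coef_mapD (f : A -> B) : additive_map f ->
  additive_map (@coef_map E A B f).
Proof.
move=> fD; apply: (malg_sumD (F := fun k a => << f a *g k >>)) => k x y.
by rewrite fD monalgUD.
Qed.

Lemma coef_mapU (f : A -> B) a (k : E) : additive_map f ->
  coef_map f << a *g k >> = << f a *g k >>.
Proof.
move=> fD; rewrite /coef_map (malg_sumU (F := fun k a => << f a *g k >>)) // => i.
by rewrite addm0 // monalgU0.
Qed.

Lemma mcoeff_coef_map (f : A -> B) (p : {malg A[E]}) k : additive_map f ->
  (coef_map f p)@_k = f p@_k.
Proof.
move=> fD; move: p; apply: malg_ext => [p q|p q|i a].
- by rewrite coef_mapD // mcoeffD.
- by rewrite mcoeffD fD.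
by rewrite coef_mapU // !mcoeffU addmMn.
Qed.

End CoefMap.

Section ExpMap.
Variables (E E' : choiceType) (A : zmodType) (h : E -> E').

Lemma exp_mapD : additive_map (@exp_map E E' A h).
Proof.
apply: (malg_sumD (F := fun k a => << a *g h k >>)) => k x y.
exact: monalgUD.
Qed.

Lemma exp_mapU (a : A) k : exp_map h << a *g k >> = << a *g h k >>.
Proof.
rewrite /exp_map (malg_sumU (F := fun k a => << a *g h k >>)) // => i.
by rewrite monalgU0.
Qed.

End ExpMap.

Section SubstLam.
Variables (A V : zmodType).
Implicit Types (s : V -> V) (f : A -> V) (p : lpoly A).

Lemma subst_lamD s f : additive_map s -> additive_map f ->
  additive_map (subst_lam s f).
Proof.
move=> sD fD.
apply: (malg_sumD (F := fun n a => iter n s (f a))) => n x y.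
by rewrite fD addm_iter.
Qed.

Lemma subst_lamU s f a n : additive_map s -> additive_map f ->
  subst_lam s f << a *g n >> = iter n s (f a).
Proof.
move=> sD fD; rewrite /subst_lam (malg_sumU (F := fun n a => iter n s (f a))) //.
by move=> k; rewrite (addm0 fD) (addm0 (addm_iter _ sD)).
Qed.

Lemma subst_lam_const s f a : additive_map s -> additive_map f ->
  subst_lam s f (const1 a) = f a.
Proof. exact: subst_lamU. Qed.

Lemma subst_lam_mul s f p : additive_map s -> additive_map f ->
  subst_lam s f (mul_lam1 p) = s (subst_lam s f p).
Proof.
move=> sD fD; have SD := subst_lamD sD fD.
move: p; apply: malg_ext => [p q|p q|n a].
- by rewrite /mul_lam1 exp_mapD SD.
- by rewrite SD sD.
by rewrite /mul_lam1 exp_mapU !subst_lamU.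
Qed.

Lemma eq_subst_lam s s' f f' p : s =1 s' -> (forall n, f p@_n = f' p@_n) ->
  subst_lam s f p = subst_lam s' f' p.
Proof.
by move=> ss' ff'; apply: eq_bigr => n _; rewrite ff'; apply: eq_iter.
Qed.

Lemma morph_subst_lam (W : zmodType) (g : V -> W) s (s' : W -> W) f p :
  additive_map g -> (forall x, g (s x) = s' (g x)) ->
  g (subst_lam s f p) = subst_lam s' (g \o f) p.
Proof.
move=> gD gs; rewrite /subst_lam addm_sum //; apply: eq_bigr => n _.
exact: iter_comm.
Qed.

End SubstLam.

Lemma subst_lam_coef_map (A B V : zmodType) (s : V -> V) (f : B -> V)
    (h : A -> B) (p : lpoly A) :
  additive_map s -> additive_map f -> additive_map h ->
  subst_lam s f (coef_map h p) = subst_lam s (f \o h) p.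
Proof.
move=> sD fD hD; have fhD : additive_map (f \o h) by move=> x y; rewrite /= hD fD.
have SD := subst_lamD sD fD; have ShD := subst_lamD sD fhD.
move: p; apply: malg_ext => [p q|p q|n a].
- by rewrite coef_mapD // SD.
- by rewrite ShD.
by rewrite coef_mapU // !subst_lamU.
Qed.

Section ConstMul.
Variable A : zmodType.

Lemma const1D : additive_map (@const1 A).
Proof. by move=> x y; rewrite /const1 monalgUD. Qed.

Lemma const2D : additive_map (@const2 A).
Proof. by move=> x y; rewrite /const2 monalgUD. Qed.

Lemma mul_lam1D : additive_map (@mul_lam1 A). Proof. exact: exp_mapD. Qed.
Lemma mul_lamD : additive_map (@mul_lam A). Proof. exact: exp_mapD. Qed.
Lemma mul_muD : additive_map (@mul_mu A). Proof. exact: exp_mapD. Qed.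

Lemma mul_lam_muD : additive_map (@mul_lam_mu A).
Proof. by move=> p q; rewrite /mul_lam_mu mul_lamD mul_muD addrACA. Qed.

Lemma mul_lam_muC (p : lmpoly A) : mul_lam (mul_mu p) = mul_mu (mul_lam p).
Proof.
move: p; apply: malg_ext => [p q|p q|n a].
- by rewrite mul_muD mul_lamD.
- by rewrite mul_lamD mul_muD.
by rewrite /mul_mu /mul_lam !exp_mapU.
Qed.

End ConstMul.

Lemma exp_map_coef_map (E E' : choiceType) (A B : zmodType) (h : E -> E')
    (f : A -> B) (p : {malg A[E]}) : additive_map f ->
  exp_map h (coef_map f p) = coef_map f (exp_map h p).
Proof.
move=> fD; move: p; apply: malg_ext => [p q|p q|k a].
- by rewrite coef_mapD // exp_mapD.
- by rewrite exp_mapD coef_mapD.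
by rewrite coef_mapU // !exp_mapU coef_mapU.
Qed.

(** * Tensor products of modules and of polynomials *)

Definition biadditive (U V W : zmodType) (B : U -> V -> W) : Prop :=
  (forall v, additive_map (B^~ v)) /\ (forall u, additive_map (B u)).

Section TensMalg.
Variables (P : comNzRingType) (M N : lmodType P).
Variables (E : choiceType) (op : E -> E -> E).

(** The law [op] on exponents is a parameter: addition on [nat] gives [tens_lam], componentwise
    addition on pairs gives [tens_lmpoly]. *)
Definition tens_malg (p : {malg M[E]}) (q : {malg N[E]}) :
    {malg (tensor M N)[E]} :=
  \sum_(m <- msupp p) \sum_(n <- msupp q) << tens p@_m q@_n *g op m n >>.

Lemma tens_malgDr p : additive_map (tens_malg p).
Proof.
move=> q q'; rewrite /tens_malg -big_split; apply: eq_bigr => m _ /=.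
apply: (malg_sumD (F := fun n b => << tens p@_m b *g op m n >>)) => n x y.
by rewrite tensDr monalgUD.
Qed.

Lemma tens_malgDl q : additive_map (tens_malg^~ q).
Proof.
apply: (malg_sumD
  (F := fun m a => \sum_(n <- msupp q) << tens a q@_n *g op m n >>)) => m x y.
by rewrite -big_split; apply: eq_bigr => n _; rewrite tensDl monalgUD.
Qed.

Lemma tens_malgU a m b n :
  tens_malg << a *g m >> << b *g n >> = << tens a b *g op m n >>.
Proof.
rewrite /tens_malg (malg_sumU (F := fun m a =>
  \sum_(n' <- msupp << b *g n >>) << tens a << b *g n >>@_n' *g op m n' >>)).
  rewrite (malg_sumU (F := fun n b => << tens a b *g op m n >>)) // => k.
  by rewrite (addm0 (tensDr a)) monalgU0.
move=> k; apply: big1 => l _.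
by rewrite (addm0 (fun x y => tensDl x y _)) monalgU0.
Qed.

Lemma biadditive_malg_ext (V : zmodType)
    (f g : {malg M[E]} -> {malg N[E]} -> V) :
  biadditive f -> biadditive g ->
  (forall m a n b, f << a *g m >> << b *g n >> = g << a *g m >> << b *g n >>) ->
  forall p q, f p q = g p q.
Proof.
move=> [fl fr] [gl gr] fg p q.
move: p; apply: malg_ext => // m a; move: q; apply: malg_ext => // n b.
Qed.

Lemma tens_malg_biadditive : biadditive tens_malg.
Proof. by split; [apply: tens_malgDl|apply: tens_malgDr]. Qed.

Lemma tens_malg_exp_mapl (h h' : E -> E) p q :
  (forall m n, h' (op m n) = op (h m) n) ->
  exp_map h' (tens_malg p q) = tens_malg (exp_map h p) q.
Proof.
move=> hop; apply: (biadditive_malg_ext (f := fun p q => exp_map h' _)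
  (g := fun p q => tens_malg (exp_map h p) q)) => [||m a n b].
- by split=> [u|u] x y /=; rewrite ?tens_malgDl ?tens_malgDr exp_mapD.
- split=> [u|u] x y /=; last exact: tens_malgDr.
  by rewrite exp_mapD; apply: (tens_malgDl u).
by rewrite exp_mapU !tens_malgU exp_mapU hop.
Qed.

Lemma tens_malg_exp_mapr (h h' : E -> E) p q :
  (forall m n, h' (op m n) = op m (h n)) ->
  exp_map h' (tens_malg p q) = tens_malg p (exp_map h q).
Proof.
move=> hop; apply: (biadditive_malg_ext (f := fun p q => exp_map h' _)
  (g := fun p q => tens_malg p (exp_map h q))) => [||m a n b].
- by split=> [u|u] x y /=; rewrite ?tens_malgDl ?tens_malgDr exp_mapD.
- split=> [u|u] x y /=; first exact: (tens_malgDl _).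
  by rewrite exp_mapD tens_malgDr.
by rewrite exp_mapU !tens_malgU exp_mapU hop.
Qed.

Lemma tens_malg_coef_mapl (f : M -> M) (g : tensor M N -> tensor M N) p q :
  additive_map f -> additive_map g -> (forall a b, g (tens a b) = tens (f a) b) ->
  coef_map g (tens_malg p q) = tens_malg (coef_map f p) q.
Proof.
move=> fD gD gf; apply: (biadditive_malg_ext (f := fun p q => coef_map g _)
  (g := fun p q => tens_malg (coef_map f p) q)) => [||m a n b].
- by split=> [u|u] x y /=; rewrite ?tens_malgDl ?tens_malgDr coef_mapD.
- split=> [u|u] x y /=; last exact: tens_malgDr.
  by rewrite coef_mapD //; apply: (tens_malgDl u).
by rewrite coef_mapU // !tens_malgU coef_mapU // gf.
Qed.

Lemma tens_malg_coef_mapr (f : N -> N) (g : tensor M N -> tensor M N) p q :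
  additive_map f -> additive_map g -> (forall a b, g (tens a b) = tens a (f b)) ->
  coef_map g (tens_malg p q) = tens_malg p (coef_map f q).
Proof.
move=> fD gD gf; apply: (biadditive_malg_ext (f := fun p q => coef_map g _)
  (g := fun p q => tens_malg p (coef_map f q))) => [||m a n b].
- by split=> [u|u] x y /=; rewrite ?tens_malgDl ?tens_malgDr coef_mapD.
- split=> [u|u] x y /=; first exact: (tens_malgDl _).
  by rewrite coef_mapD // tens_malgDr.
by rewrite coef_mapU // !tens_malgU coef_mapU // gf.
Qed.

End TensMalg.

(** * Universal property of the tensor product *)

Section Lift.
Variables (P : comNzRingType) (M N : lmodType P) (V : zmodType).
Implicit Types (f : M -> N -> V) (t : tensor M N).

(** The target is an abelian group rather than a module because a lambda-product is sesquilinear,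
    not C[d]-linear. *)
Definition balanced f : Prop :=
  biadditive f /\ forall c m n, f (c *: m) n = f m (c *: n).

(** As [V] carries no scalars, the coefficient is made to act on the first component. *)
Definition free_lift f (x : free_mod M N) : V :=
  \sum_(k <- msupp x) f (x@_k *: k.1) k.2.

Definition tensor_lift f t : V :=
  free_lift f (repr (t : Quotient.quot (@tensor_rel P M N))).

Lemma free_liftD f : balanced f -> additive_map (free_lift f).
Proof.
move=> [[fl _] _].
apply: (malg_sumD (F := fun k (c : P) => f (c *: k.1) k.2)) => k c d.
by rewrite scalerDl fl.
Qed.

Lemma free_liftU f c m n : balanced f ->
  free_lift f << c *g (m, n) >> = f (c *: m) n.
Proof.
move=> [[fl _] _].
rewrite /free_lift (malg_sumU (F := fun k (c : P) => f (c *: k.1) k.2)) // => k.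
by rewrite scale0r (addm0 (fl k.2)).
Qed.

Lemma malgZU (c d : P) (k : M * N) : c *: << d *g k >> = << c * d *g k >>.
Proof. by apply/malgP => l; rewrite mcoeffZ !mcoeffU mulrnAr. Qed.

(** This makes [tensor_lift] independent of the representative chosen by [repr]. *)
Lemma free_lift_rel f x : balanced f -> x \in tensor_rel (M:=M) (N:=N) ->
  free_lift f x = 0.
Proof.
move=> fb; have FD := free_liftD fb; case: (fb) => [[fl fr] fbal].
have FB := addmB FD; have fB n := addmB (fl n).
move/tensor_relP; elim=> [|c y z gy _ IH]; first exact: addm0.
rewrite FD IH addr0; case: gy => [m m' n|m n n'|d m n|d m n];
  rewrite !scalerBr ?scalerA !malgZU ?mulr1 !FB !free_liftU //.
- by rewrite scalerDr fl -addrA -opprD addrN.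
- by rewrite fr -addrA -opprD addrN.
- by rewrite scalerA subrr.
by rewrite -fbal scalerA (mulrC d) subrr.
Qed.

Lemma tensor_lift_pi f x : balanced f -> tensor_lift f (tensor_pi x) = free_lift f x.
Proof.
move=> fb; apply/eqP; rewrite -subr_eq0 -(addmB (free_liftD fb)).
apply/eqP/free_lift_rel => //; apply/tensor_piP; exact: tensor_piK.
Qed.

Lemma tensor_liftE f m n : balanced f -> tensor_lift f (tens m n) = f m n.
Proof. by move=> fb; rewrite tensor_lift_pi // free_liftU // scale1r. Qed.

Lemma tensor_liftD f : balanced f -> additive_map (tensor_lift f).
Proof.
move=> fb s t; rewrite -[s]tensor_piK -[t]tensor_piK -tensor_piD.
by rewrite !tensor_lift_pi // free_liftD.
Qed.

(** All three lifts evaluate at the same representative of [t], so the identity holds term by term.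
    It transfers additivity from the integrand to an iterated lift. *)
Lemma tensor_lift_add f g h t : (forall m n, h m n = f m n + g m n) ->
  tensor_lift h t = tensor_lift f t + tensor_lift g t.
Proof. by move=> hfg; rewrite -big_split; apply: eq_bigr => k _; apply: hfg. Qed.

Lemma eq_tensor_lift f g t : (forall m n, f m n = g m n) ->
  tensor_lift f t = tensor_lift g t.
Proof. by move=> fg; apply: eq_bigr => k _; apply: fg. Qed.

End Lift.

Section TensorInd.
Variables (P : comNzRingType) (M N : lmodType P).

Lemma tensor_ind (Q : tensor M N -> Prop) : Q 0 ->
  (forall m n t, Q t -> Q (tens m n + t)) -> forall t, Q t.
Proof.
move=> Q0 QD t; rewrite -[t]tensor_piK; move: (repr _) => x.
(* A multiple of a basis vector of the free module is still a pure tensor, the scalar being absorbed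
   by the left component. *)
have piE c k : tensor_pi (<< c *g k >> : free_mod M N) = tens (c *: k.1) k.2.
  by case: k => m n; rewrite tensZl -[RHS]tensor_piZ malgZU mulr1.
rewrite (monalgE x); elim: (msupp x : seq _) => [|k s IH].
  by rewrite big_nil (addm0 (@tensor_piD _ M N)).
by rewrite big_cons tensor_piD piE; apply: QD.
Qed.

End TensorInd.

(** * Nested products, gradings and commutativity *)

Section Nest.
Variables (A : zmodType).
Implicit Types (s t : lmpoly A -> lmpoly A) (op : A -> A -> lpoly A).

Lemma eq_nest_r s s' t t' op1 op2 a b c : s =1 s' -> t =1 t' ->
  nest_r s t op1 op2 a b c = nest_r s' t' op1 op2 a b c.
Proof.
by move=> ss' tt'; apply: eq_subst_lam => // n; apply: eq_subst_lam.
Qed.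

Lemma eq_nest_l s s' t t' op1 op2 a b c : s =1 s' -> t =1 t' ->
  nest_l s t op1 op2 a b c = nest_l s' t' op1 op2 a b c.
Proof.
by move=> ss' tt'; apply: eq_subst_lam => // n; apply: eq_subst_lam.
Qed.

Lemma subst_lam_sgn (V : zmodType) (s : V -> V) (f : A -> V) b p :
  additive_map s -> subst_lam s (fun x => sgn b (f x)) p = sgn b (subst_lam s f p).
Proof.
move=> sD; rewrite (morph_subst_lam (s' := s)) //; first exact: sgnD.
by move=> x; rewrite addm_sgn.
Qed.

Lemma subst_lam_const2D s : additive_map s ->
  additive_map (subst_lam s (@const2 A)).
Proof. by move=> sD; apply: subst_lamD => //; apply: const2D. Qed.

(* The substitution lambda := s, mu := t. *)
Definition subst2 s t (p : lmpoly A) : lmpoly A :=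
  \sum_(e <- msupp p) iter e.1 s (iter e.2 t (const2 p@_e)).

Section Subst2.
Variables s t : lmpoly A -> lmpoly A.
Hypotheses (sD : additive_map s) (tD : additive_map t).
Hypothesis st : forall x, s (t x) = t (s x).

Lemma subst2D : additive_map (subst2 s t).
Proof.
apply: (malg_sumD (F := fun e a => iter e.1 s (iter e.2 t (const2 a)))).
by move=> e x y; rewrite const2D (addm_iter _ tD) (addm_iter _ sD).
Qed.

Lemma subst2U a e : subst2 s t << a *g e >> = iter e.1 s (iter e.2 t (const2 a)).
Proof.
rewrite /subst2
  (malg_sumU (F := fun e a => iter e.1 s (iter e.2 t (const2 a)))) // => k.
by rewrite (addm0 (@const2D A)) (addm0 (addm_iter _ tD)) (addm0 (addm_iter _ sD)).
Qed.

Lemma subst2_const a : subst2 s t (const2 a) = const2 a.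
Proof. exact: subst2U. Qed.

Lemma subst2_lam p : subst2 s t (mul_lam p) = s (subst2 s t p).
Proof.
move: p; apply: malg_ext => [p q|p q|e a]; first by rewrite mul_lamD subst2D.
  by rewrite subst2D sD.
by rewrite /mul_lam exp_mapU !subst2U.
Qed.

(** [subst2] applies the powers of [s] outside those of [t], so [t] has to be commuted past them;
    this is where [st] enters. *)
Lemma subst2_mu p : subst2 s t (mul_mu p) = t (subst2 s t p).
Proof.
move: p; apply: malg_ext => [p q|p q|e a]; first by rewrite mul_muD subst2D.
  by rewrite subst2D tD.
by rewrite /mul_mu exp_mapU !subst2U /= -(iter_comm (g := t) (s := s)).
Qed.

Lemma subst2_subst_lam (u u' : lmpoly A -> lmpoly A) p :
  (forall x, subst2 s t (u x) = u' (subst2 s t x)) ->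
  subst2 s t (subst_lam u (@const2 A) p) = subst_lam u' (@const2 A) p.
Proof.
move=> uu'; rewrite (morph_subst_lam (s' := u')) //; last exact: subst2D.
by apply: eq_subst_lam => // n; apply: subst2_const.
Qed.

Lemma subst2_nest_r (u v u' v' : lmpoly A -> lmpoly A) op1 op2 a b c :
  (forall x, subst2 s t (u x) = u' (subst2 s t x)) ->
  (forall x, subst2 s t (v x) = v' (subst2 s t x)) ->
  subst2 s t (nest_r u v op1 op2 a b c) = nest_r u' v' op1 op2 a b c.
Proof.
move=> uu' vv'; rewrite /nest_r (morph_subst_lam (s' := v')) //.
  by apply: eq_subst_lam => // n; apply: subst2_subst_lam.
exact: subst2D.
Qed.

Lemma subst2_nest_l (u v u' v' : lmpoly A -> lmpoly A) op1 op2 a b c :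
  (forall x, subst2 s t (u x) = u' (subst2 s t x)) ->
  (forall x, subst2 s t (v x) = v' (subst2 s t x)) ->
  subst2 s t (nest_l u v op1 op2 a b c) = nest_l u' v' op1 op2 a b c.
Proof.
move=> uu' vv'; rewrite /nest_l (morph_subst_lam (s' := u')) //.
  by apply: eq_subst_lam => // n; apply: subst2_subst_lam.
exact: subst2D.
Qed.

Lemma subst2_lam_mu p :
  subst2 s t (mul_lam_mu p) = s (subst2 s t p) + t (subst2 s t p).
Proof. by rewrite /mul_lam_mu subst2D subst2_lam subst2_mu. Qed.

End Subst2.
End Nest.

(** * Homogeneous components *)

Section Graded.
Variables (C : fieldType) (A : lmodType {poly C}) (gr : bool -> A -> Prop).

Lemma derD : additive_map (@der C A).
Proof. by move=> x y; rewrite /der scalerDr. Qed.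

Hypothesis grP : z2_graded gr.

Lemma gr_add i a b : gr i a -> gr i b -> gr i (a + b).
Proof. by move=> ga gb; rewrite -[a]scale1r -polyC1; apply: (gr_lin grP). Qed.

Lemma gr_scaleC i c a : gr i a -> gr i (c%:P *: a).
Proof.
by move=> ga; rewrite -[_ *: a]addr0; apply: (gr_lin grP) => //; apply: gr_zero.
Qed.

Lemma gr_opp i a : gr i a -> gr i (- a).
Proof. by move=> ga; rewrite -scaleN1r -polyC1 -polyCN; apply: gr_scaleC. Qed.

Lemma gr_scale i p a : gr i a -> gr i (p *: a).
Proof.
move=> ga; elim/poly_ind: p => [|p c IH].
  by rewrite scale0r; apply: gr_zero.
rewrite scalerDl addrC mulrC -scalerA; apply: gr_lin => //; exact: gr_der.
Qed.

(** Both components are packed into one pair so that a single choice by [cid] yields the two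
    projections consistently. *)
Lemma gr_split a : exists ab : A * A,
  [/\ gr false ab.1, gr true ab.2 & a = ab.1 + ab.2].
Proof. by have [a0 [a1 h]] := gr_sum grP a; exists (a0, a1). Qed.

Definition gr_proj (i : bool) (a : A) : A :=
  if i then (sval (cid (gr_split a))).2 else (sval (cid (gr_split a))).1.

Lemma gr_projP i a : gr i (gr_proj i a).
Proof. by rewrite /gr_proj; case: cid => [[x y] []]; case: i. Qed.

Lemma gr_projE a : a = gr_proj false a + gr_proj true a.
Proof. by rewrite /gr_proj; case: cid => [[x y] []]. Qed.

(** The difference of the even parts equals that of the odd parts up to sign, so it is both even and
    odd. This uniqueness is what makes the chosen projections additive and C[d]-linear. *)
Lemma gr_uniq a0 a1 b0 b1 : gr false a0 -> gr true a1 -> gr false b0 ->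
  gr true b1 -> a0 + a1 = b0 + b1 -> a0 = b0 /\ a1 = b1.
Proof.
move=> ga0 ga1 gb0 gb1 e.
have e' : a0 - b0 = b1 - a1.
  by apply/eqP; rewrite subr_eq addrAC (addrC b1) -e addrK.
have z : a0 - b0 = 0.
  apply: (gr_direct grP); first by apply/gr_add/gr_opp.
  by rewrite e'; apply/gr_add/gr_opp.
split; first by apply/eqP; rewrite -subr_eq0 z.
by apply/esym/eqP; rewrite -subr_eq0 -e' z.
Qed.

Lemma gr_proj_id i a : gr i a -> gr_proj i a = a /\ gr_proj (~~ i) a = 0.
Proof.
have g0 k : gr k 0 by exact: gr_zero.
move=> ga; have := gr_projE a; case: i ga => ga e.
  have := gr_uniq (gr_projP false a) (gr_projP true a) (g0 false) ga.
  by rewrite add0r -e => /(_ erefl) [-> ->].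
have := gr_uniq (gr_projP false a) (gr_projP true a) ga (g0 true).
by rewrite addr0 -e => /(_ erefl) [-> ->].
Qed.

Lemma gr_proj_split i a0 a1 : gr false a0 -> gr true a1 ->
  gr_proj i (a0 + a1) = if i then a1 else a0.
Proof.
move=> g0 g1; have := gr_projE (a0 + a1).
have [p q] := (gr_projP false (a0 + a1), gr_projP true (a0 + a1)).
by case/(gr_uniq g0 g1 p q) => e0 e1; case: i.
Qed.

Lemma gr_projD i : additive_map (gr_proj i).
Proof.
move=> a b; rewrite {1}(gr_projE a) {1}(gr_projE b) addrACA.
by rewrite gr_proj_split; [case: i|apply: gr_add..]; try exact: gr_projP.
Qed.

Lemma gr_projZ i p a : gr_proj i (p *: a) = p *: gr_proj i a.
Proof.
rewrite {1}(gr_projE a) scalerDr.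
by rewrite gr_proj_split; [case: i|apply/gr_scale/gr_projP..].
Qed.

End Graded.

Arguments gr_proj : simpl never.

Section ConformalProduct.
Variables (C : fieldType) (A : lmodType {poly C}).
Implicit Types (op : A -> A -> lpoly A).

Lemma cscaleD (c : C) : additive_map (@cscale C A c).
Proof. by apply: coef_mapD => x y; rewrite scalerDr. Qed.

Lemma cscale1 p : @cscale C A 1 p = p.
Proof.
apply/malgP => n; rewrite mcoeff_coef_map ?polyC1 ?scale1r //.
by move=> x y; rewrite scalerDr.
Qed.

Lemma c_bilinear_biadditive op : c_bilinear op -> biadditive op.
Proof.
move=> [l r]; split=> [b|a] x y /=.
  by have := l 1 x y b; rewrite polyC1 scale1r cscale1.
by have := r 1 a x y; rewrite polyC1 scale1r cscale1.
Qed.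

(** [e = false] is commutativity and [e = true] is skew-symmetry, so that both are transported by
    the same lemmas. *)
Definition twisted_commutative (e : bool) (gr : bool -> A -> Prop) op : Prop :=
  forall i j a b, gr i a -> gr j b -> op a b = sgn (e (+) (i && j)) (op_opp op b a).

Local Notation D := (@coef_map (nat * nat)%type A A (@der C A)).

Lemma opp_shiftD : additive_map (fun p : lpoly A => - coef_map (@der C A) p - mul_lam1 p).
Proof.
move=> p q; rewrite coef_mapD ?mul_lam1D; last exact: derD.
by rewrite !opprD addrACA.
Qed.

(** Substituting [s] for lambda after lambda := - d - lambda amounts to substituting [- d - s],
    where the operator [d] is what the derivation becomes through [f]. It depends on the place of
    the inner product: [- t] inside the left argument of a product at [t], [D + s] inside the right
    argument of a product at [s], and [D] for an outermost product. *)
Lemma subst_lam_op_opp (V : zmodType) (s d : V -> V) (f : A -> V) op a b :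
  additive_map s -> additive_map f -> additive_map d ->
  (forall x, f (der x) = d (f x)) -> (forall x, d (s x) = s (d x)) ->
  subst_lam s f (op_opp op a b) = subst_lam (fun x => - d x - s x) f (op a b).
Proof.
move=> sD fD dD fd ds; have SD := subst_lamD sD fD.
rewrite /op_opp (morph_subst_lam (s' := fun x => - d x - s x)) //.
  by apply: eq_subst_lam => // n /=; rewrite subst_lam_const.
move=> p; rewrite (addmB SD) (addmN SD) subst_lam_mul //; congr (- _ - _).
rewrite subst_lam_coef_map //; last exact: derD.
rewrite (morph_subst_lam (g := d) (s' := s)) //.
by apply: eq_subst_lam => // n /=; exact: fd.
Qed.

Lemma D_additive : additive_map D.
Proof. exact/coef_mapD/derD. Qed.

Lemma subst_lam_const2_der (s : lmpoly A -> lmpoly A) p :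
  additive_map s -> (forall x, D (s x) = s (D x)) ->
  subst_lam s (@const2 A) (coef_map (@der C A) p) = D (subst_lam s (@const2 A) p).
Proof.
move=> sD Ds; rewrite subst_lam_coef_map //; [|exact: const2D|exact: derD].
rewrite (morph_subst_lam (s' := s)) //; last exact: D_additive.
apply: eq_subst_lam => // n; rewrite /= /const2 coef_mapU //; exact: derD.
Qed.

(** * Commuting the arguments of a nested product *)

Section Flip.
Variables (gr : bool -> A -> Prop) (s t : lmpoly A -> lmpoly A).
Hypotheses (sD : additive_map s) (tD : additive_map t).
Hypothesis st : forall x, s (t x) = t (s x).
Variables (e : bool) (op o : A -> A -> lpoly A).
Hypotheses (opC : conformal_superalgebra gr op) (oC : conformal_superalgebra gr o).

(** In the left argument of a product at [t] the derivation acts as [- t], so the flipped inner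
    product is taken at - (- t) - s. *)
Lemma nest_l_swap i j a b c : twisted_commutative e gr o -> gr i a -> gr j b ->
  nest_l s t o op a b c
  = sgn (e (+) (i && j)) (nest_l (fun x => t x - s x) t o op b a c).
Proof.
move=> oe ga gb; have [opl opr] := c_bilinear_biadditive (cs_bilinear opC).
have fD : additive_map (fun d => subst_lam t (@const2 A) (op d c)).
  by move=> x y; rewrite opl subst_lam_const2D.
rewrite /nest_l (oe i j a b) // (addm_sgn _ _ (subst_lamD sD fD)); congr sgn.
rewrite (subst_lam_op_opp (d := fun x => - t x)) //.
- by apply: eq_subst_lam => // x; rewrite opprK.
- by move=> x y; rewrite tD opprD.
- move=> x; rewrite (cs_derl opC) (addmN (subst_lam_const2D tD)).
  by rewrite subst_lam_mul //; exact: const2D.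
by move=> x; rewrite (addmN sD) st.
Qed.

(** In the right argument of a product at [s] the derivation acts as [D + s], which determines the
    new inner variable. *)
Lemma nest_r_swap j k a b c : twisted_commutative e gr o -> gr j b -> gr k c ->
  (forall x, D (s x) = s (D x)) -> (forall x, D (t x) = t (D x)) ->
  nest_r s t op o a b c
  = sgn (e (+) (j && k)) (nest_r s (fun x => - (D x + s x) - t x) op o a c b).
Proof.
move=> oe gb gc Ds Dt; have [opl opr] := c_bilinear_biadditive (cs_bilinear opC).
have fD : additive_map (fun d => subst_lam s (@const2 A) (op a d)).
  by move=> x y; rewrite opr subst_lam_const2D.
rewrite /nest_r (oe j k b c) // (addm_sgn _ _ (subst_lamD tD fD)); congr sgn.
rewrite (subst_lam_op_opp (d := fun x => D x + s x)) //.
- by move=> x y; rewrite D_additive sD addrACA.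
- move=> x; rewrite (cs_derr opC) (subst_lam_const2D sD).
  rewrite subst_lam_const2_der // subst_lam_mul //; exact: const2D.
by move=> x; rewrite Dt st tD.
Qed.

(** It is the outer product that is flipped here; every coefficient of the inner one has parity
    [i (+) j]. *)
Lemma nest_l_to_r i j k a b c : twisted_commutative e gr op ->
  gr i a -> gr j b -> gr k c -> (forall x, D (t x) = t (D x)) ->
  nest_l s t o op a b c
  = sgn (e (+) ((i (+) j) && k)) (nest_r (fun x => - D x - t x) s op o c a b).
Proof.
move=> ope ga gb gc Dt; rewrite /nest_l /nest_r -subst_lam_sgn //.
apply: eq_subst_lam => // n.
rewrite (ope _ _ _ _ (cs_parity oC ga gb n) gc).
rewrite (addm_sgn _ _ (subst_lam_const2D tD)); congr sgn.
rewrite (subst_lam_op_opp (d := D)) //.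
- exact: const2D.
- exact: D_additive.
by move=> x; rewrite /const2 coef_mapU //; apply: derD.
Qed.

End Flip.
End ConformalProduct.

(** * Identities in a transposed Poisson conformal superalgebra *)

Section ZmodIdentities.
Variables (V : zmodType) (d l m n : V).

Lemma opp_subACA : - (d + m) - (l + n) = - d - l + (- m - n).
Proof. by rewrite !opprD addrACA. Qed.

(** For nu = - d - l - m this says - d - (nu + l) = m; the next lemma likewise says - (d + m) - nu =
    l. *)
Lemma opp_sub_sum : - d - (- d - (l + m) + l) = m.
Proof.
by rewrite opprD opprB opprK (addrAC (l + m)) (addrC _ d) addKr (addrC l) addrK.
Qed.

Lemma opp_add_sub : - (d + m) - (- d - (l + m)) = l.
Proof. by rewrite opprB opprK -(addrA l) (addrC m d) (addrC l) addKr. Qed.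

End ZmodIdentities.

Section TPCSAIdentities.
Local Opaque subst_lam exp_map coef_map nest_r nest_l.
Variables (C : fieldType) (A : lmodType {poly C}) (gr : bool -> A -> Prop).
Variables mul br : A -> A -> lpoly A.
Hypothesis tp : tpcsa gr mul br.

Local Notation lam := (@mul_lam A).
Local Notation mu := (@mul_mu A).
Local Notation lam_mu := (@mul_lam_mu A).
Local Notation D := (@coef_map (nat * nat)%type A A (@der C A)).

Let mulC : conformal_superalgebra gr mul := tpcsa_conformal tp.
Let brC : conformal_superalgebra gr br := lcs_conformal (tpcsa_lie tp).

Lemma tpcsa_mul_twisted : twisted_commutative false gr mul.
Proof. by move=> i j a b ga gb; rewrite (tpcsa_commutative tp ga gb). Qed.

Lemma tpcsa_br_twisted : twisted_commutative true gr br.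
Proof.
move=> i j a b ga gb; rewrite (lcs_skew (tpcsa_lie tp) ga gb) ksignE.
by case: (i && j); rewrite /= ?opprK.
Qed.

Let mulT := tpcsa_mul_twisted.
Let brT := tpcsa_br_twisted.

Let lamD := @mul_lamD A.
Let muD := @mul_muD A.
Let lmD := @mul_lam_muD A.
Let DD := @D_additive C A.

Let Dlam x : D (lam x) = lam (D x).
Proof. by rewrite /mul_lam exp_map_coef_map //; apply: derD. Qed.

Let Dmu x : D (mu x) = mu (D x).
Proof. by rewrite /mul_mu exp_map_coef_map //; apply: derD. Qed.

Let Dlm x : D (lam_mu x) = lam_mu (D x).
Proof. by rewrite /mul_lam_mu DD Dlam Dmu. Qed.

Let lam_lm x : lam (lam_mu x) = lam_mu (lam x).
Proof. by rewrite /mul_lam_mu lamD mul_lam_muC. Qed.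

Let mu_lm x : mu (lam_mu x) = lam_mu (mu x).
Proof. by rewrite /mul_lam_mu muD mul_lam_muC. Qed.

Section Subst.
Variables s t : lmpoly A -> lmpoly A.
Hypotheses (sD : additive_map s) (tD : additive_map t).
Hypothesis st : forall x, s (t x) = t (s x).

(** An axiom is an identity in A[lambda, mu]; applying [subst2 s t] specialises it to commuting
    operators, including ones that involve the derivation. *)
Lemma tpcsa_assoc_subst a b c :
  nest_r s t mul mul a b c = nest_l s (fun x => s x + t x) mul mul a b c.
Proof.
have := congr1 (subst2 s t) (tpcsa_associative tp a b c).
rewrite (subst2_nest_r sD tD (u' := s) (v' := t)).
- rewrite (subst2_nest_l sD tD (u' := s) (v' := fun x => s x + t x)) //.
    exact: subst2_lam.
  exact: subst2_lam_mu.
- exact: subst2_lam.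
- exact: subst2_mu.
Qed.

Lemma tpcsa_compat_subst i j a b c : gr i a -> gr j b ->
  nest_r s t mul br a b c *+ 2
  = nest_l s (fun x => s x + t x) mul br a b c
    + sgn (i && j) (nest_r t s br mul b a c).
Proof.
move=> ga gb; have SD := subst2D sD tD.
have := congr1 (subst2 s t) (tpcsa_compat tp c ga gb).
rewrite SD (addmMn SD) (addm_sgn _ _ SD).
rewrite (subst2_nest_r sD tD (u' := s) (v' := t)); last 2 first.
- exact: subst2_lam.
- exact: subst2_mu.
rewrite (subst2_nest_r sD tD (u' := t) (v' := s)); last 2 first.
- exact: subst2_mu.
- exact: subst2_lam.
rewrite (subst2_nest_l sD tD (u' := s) (v' := fun x => s x + t x)) //.
  exact: subst2_lam.
exact: subst2_lam_mu.
Qed.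

End Subst.

Section Homogeneous.
Variables (i j k : bool) (a b c : A).
Hypotheses (ga : gr i a) (gb : gr j b) (gc : gr k c).

(** Flipping an inner product at mu under an outer one at lambda + mu replaces mu by (lambda + mu) -
    mu = lambda. *)
Lemma tpcsa_nest_l_swap op : conformal_superalgebra gr op ->
  nest_l mu lam_mu mul op b a c = sgn (i && j) (nest_l lam lam_mu mul op a b c).
Proof.
move=> opC; rewrite (@nest_l_swap _ _ _ _ _ muD lmD mu_lm _ _ _ opC j i b a c mulT gb ga).
rewrite andbC; congr (sgn _ _); apply: eq_nest_l => x; last by [].
by rewrite /mul_lam_mu addrK.
Qed.

(** b(ac) = (ba)c, which is (ab)c = a(bc) up to the sign of exchanging a and b. *)
Lemma tpcsa_mul_swap :
  nest_r mu lam mul mul b a c = sgn (i && j) (nest_r lam mu mul mul a b c).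
Proof.
rewrite (tpcsa_assoc_subst muD lamD) => [|x]; last by rewrite mul_lam_muC.
rewrite (tpcsa_associative tp) -(tpcsa_nest_l_swap mulC).
by apply: eq_nest_l => x; [by []|rewrite addrC].
Qed.

(** Compatibility for (b, a, c) with lambda and mu exchanged, after which (b.a) is flipped back to
    (a.b). *)
Lemma tpcsa_compat_swap :
  nest_r mu lam mul br b a c *+ 2
  = sgn (i && j) (nest_l lam lam_mu mul br a b c + nest_r lam mu br mul a b c).
Proof.
rewrite (tpcsa_compat_subst muD lamD _ _ gb ga) => [|x]; last by rewrite mul_lam_muC.
rewrite [RHS]sgnD (andbC j).
apply: (congr2 +%R); last by [].
rewrite -(tpcsa_nest_l_swap brC).
by apply: eq_nest_l => x; [by []|rewrite addrC].
Qed.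

(* Compatibility for (c, a, b) under lambda := - d - lambda - mu, mu := lambda;
   skew-symmetry and commutativity then bring the three terms back to the
   variables lambda and mu. *)
Lemma tpcsa_compat_br_mul :
  nest_l lam lam_mu br mul a b c *+ 2
  = nest_r lam mu br mul a b c - sgn (i && j) (nest_r mu lam br mul b a c).
Proof.
pose nu x : lmpoly A := - D x - lam_mu x.
have nuD : additive_map nu by move=> x y; rewrite /nu DD lmD opp_subACA.
have nu_lam x : nu (lam x) = lam (nu x).
  by rewrite /nu (addmB lamD) (addmN lamD) Dlam lam_lm.
have nu_mu x : nu (mu x) = mu (nu x).
  by rewrite /nu (addmB muD) (addmN muD) Dmu mu_lm.
have Dnu x : D (nu x) = nu (D x) by rewrite /nu (addmB DD) (addmN DD) Dlm.
pose nu_lam_sum x := nu x + lam x.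
have nlD : additive_map nu_lam_sum.
  by move=> x y; rewrite /nu_lam_sum nuD lamD addrACA.
have nl_nu x : nu (nu_lam_sum x) = nu_lam_sum (nu x).
  by rewrite /nu_lam_sum nuD nu_lam.
have Dnl x : D (nu_lam_sum x) = nu_lam_sum (D x).
  by rewrite /nu_lam_sum DD Dnu Dlam.
rewrite (@nest_l_to_r _ _ _ _ _ lamD lmD _ _ _ brC i j k a b c mulT ga gb gc Dlm).
rewrite -/nu -sgnMn (tpcsa_compat_subst nuD lamD nu_lam _ gc ga) sgnD.
(* The term [(c.a) b], with outer variable nu + lambda, is turned into [b (c.a)] at - d - (nu +
   lambda) = mu. The two inner products c.a and c.b are flipped below. *)
rewrite (@nest_l_to_r _ _ _ _ _ nuD nlD _ _ _ mulC k i j c a b brT gc ga gb Dnl).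
have Dnl_nu x : - D x - nu_lam_sum x = mu x.
  exact: opp_sub_sum.
have Dmu_nu x : - (D x + mu x) - nu x = lam x.
  exact: opp_add_sub.
have Dlam_nu x : - (D x + lam x) - nu x = mu x.
  by rewrite /nu /mul_lam_mu (addrC (lam x)) opp_add_sub.
rewrite (eq_nest_r _ _ _ _ _ Dnl_nu (frefl nu)).
have lam_nu x : lam (nu x) = nu (lam x) by rewrite nu_lam.
have mu_nu x : mu (nu x) = nu (mu x) by rewrite nu_mu.
rewrite (@nest_r_swap _ _ _ _ _ muD nuD mu_nu _ _ _ brC k i b c a mulT gc ga Dmu Dnu).
rewrite (@nest_r_swap _ _ _ _ _ lamD nuD lam_nu _ _ _ brC k j a c b mulT gc gb Dlam Dnu).
rewrite (eq_nest_r _ _ _ _ _ (frefl mu) Dmu_nu).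
rewrite (eq_nest_r _ _ _ _ _ (frefl lam) Dlam_nu).
rewrite !sgn_addb addrC.
by clear; case: i j k => [] [] [] /=; rewrite ?opprK.
Qed.

End Homogeneous.
End TPCSAIdentities.

(** * The grading of the tensor product *)

Definition triadditive (U V : zmodType) (T : U -> U -> U -> V) : Prop :=
  [/\ forall b c, additive_map (fun a => T a b c),
      forall a c, additive_map (fun b => T a b c)
    & forall a b, additive_map (T a b)].

(** In lambda^(m + n), m powers act through the left factor and n through the right one, hence the
    two conditions on [s]. The last hypothesis concerns only coefficients of [p] and [q], so that
    their parities can be used to evaluate signs. *)
Lemma tens_lam_subst_lam (C : fieldType) (M N : lmodType {poly C})
    (V1 V2 V : zmodType) (B : V1 -> V2 -> V) (s : V -> V) (s1 : V1 -> V1)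
    (s2 : V2 -> V2) (f : tensor M N -> V) (f1 : M -> V1) (f2 : N -> V2) p q :
  additive_map s -> additive_map f -> biadditive B ->
  (forall x y, s (B x y) = B (s1 x) y) -> (forall x y, s (B x y) = B x (s2 y)) ->
  (forall m n, f (tens p@_m q@_n) = B (f1 p@_m) (f2 q@_n)) ->
  subst_lam s f (tens_lam p q) = B (subst_lam s1 f1 p) (subst_lam s2 f2 q).
Proof.
move=> sD fD [Bl Br] s_s1 s_s2 fB; have SD := subst_lamD sD fD.
have iter_s1 n x y : B (iter n s1 x) y = iter n s (B x y).
  by elim: n => //= n <-.
have iter_s2 n x y : B x (iter n s2 y) = iter n s (B x y).
  by elim: n => //= n <-.
rewrite /tens_lam (addm_sum SD) {2}/subst_lam (addm_sum (Bl _)).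
apply: eq_bigr => m _; rewrite (addm_sum SD) /= {2}/subst_lam (addm_sum (Br _)).
apply: eq_bigr => n _; rewrite subst_lamU // fB iterD.
by rewrite iter_s1 iter_s2.
Qed.

Section TensorGrading.
Variables (C : fieldType) (L1 L2 : lmodType {poly C}).
Variables (gr1 : bool -> L1 -> Prop) (gr2 : bool -> L2 -> Prop).
Hypotheses (gr1P : z2_graded gr1) (gr2P : z2_graded gr2).

Local Notation L := (tensor L1 L2).
Local Notation grT := (tensor_gr gr1 gr2).

Lemma tensor_gr_tens j k a b : gr1 j a -> gr2 k b -> grT (j (+) k) (tens a b).
Proof.
move=> ga gb; rewrite -[tens a b]addr0 -[tens a b]scale1r.
by apply: span_comb; [exists j, k, a, b|apply: span_zero].
Qed.

Lemma tensor_gr_add i s t : grT i s -> grT i t -> grT i (s + t).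
Proof.
move=> gs gt; elim: gs => [|c x y gx _ IH]; first by rewrite add0r.
by rewrite -addrA; apply: span_comb.
Qed.

Lemma tensor_gr_ind i (Q : L -> Prop) : Q 0 ->
  (forall s t, Q s -> Q t -> Q (s + t)) ->
  (forall j k a b, gr1 j a -> gr2 k b -> j (+) k = i -> Q (tens a b)) ->
  forall t, grT i t -> Q t.
Proof.
move=> Q0 QD Qt t; elim=> // c x y [j [k [a [b [ga gb jk ->]]]]] _ Qy.
by apply: QD => //; rewrite -tensZl; apply: (Qt j k) => //; apply: gr_scale.
Qed.

Lemma tensor_homogeneous_ind (Q : L -> Prop) : Q 0 ->
  (forall s t, Q s -> Q t -> Q (s + t)) ->
  (forall j k a b, gr1 j a -> gr2 k b -> Q (tens a b)) -> forall t, Q t.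
Proof.
move=> Q0 QD Qt; apply: tensor_ind => // m n t Qy; apply: (QD) => //.
rewrite (gr_projE gr1P m) (gr_projE gr2P n) tensDl !tensDr.
by apply: (QD); apply: (QD); apply: Qt; apply: gr_projP.
Qed.

(** The graded pieces are spans of generators, from which it is not visible that they meet in zero.
    A well-defined projection, even tensor [i] plus odd tensor [~~ i], separates them. *)
Definition tensor_proj (i : bool) : L -> L :=
  tensor_lift (fun a b => tens (gr_proj gr1P false a) (gr_proj gr2P i b)
                          + tens (gr_proj gr1P true a) (gr_proj gr2P (~~ i) b)).

Lemma tensor_proj_balanced i :
  balanced (fun a b => tens (gr_proj gr1P false a) (gr_proj gr2P i b)
                       + tens (gr_proj gr1P true a) (gr_proj gr2P (~~ i) b)).
Proof.
split; first by split=> u x y /=; rewrite !gr_projD ?tensDl ?tensDr addrACA.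
by move=> c m n; rewrite !gr_projZ !tensZl !tensZr.
Qed.

Lemma tensor_projD i : additive_map (tensor_proj i).
Proof. exact/tensor_liftD/tensor_proj_balanced. Qed.

Lemma tensor_proj_gr i k t : grT k t -> tensor_proj i t = if i == k then t else 0.
Proof.
move: t; apply: tensor_gr_ind => [|s t|j l a b ga gb <-].
- by rewrite (addm0 (@tensor_projD i)); case: ifP.
- by rewrite tensor_projD => -> ->; case: ifP; rewrite ?addr0.
rewrite /tensor_proj tensor_liftE; last exact: tensor_proj_balanced.
have T0 (x : L1) : tens x (0 : L2) = 0 by apply: (addm0 (tensDr x)).
have T0l (x : L2) : tens (0 : L1) x = 0 by apply: (addm0 (fun u v => tensDl u v x)).
have [p p'] := gr_proj_id gr1P ga; have [q q'] := gr_proj_id gr2P gb.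
by case: i j l ga gb p p' q q' => [] [] [] _ _ /= -> -> -> ->;
  rewrite ?T0 ?T0l ?addr0 ?add0r.
Qed.

Lemma tensor_graded : z2_graded grT.
Proof.
split=> [i|i c s t gs gt|i t|t|t g0 g1].
- exact: span_zero.
- apply: tensor_gr_add => //; move: s gs; apply: tensor_gr_ind.
  + by rewrite scaler0; apply: span_zero.
  + by move=> x y gx gy; rewrite scalerDr; apply: tensor_gr_add.
  move=> j k a b ga gb <-; rewrite -tensZl; apply: tensor_gr_tens => //.
  exact: gr_scale.
- move: t; apply: tensor_gr_ind.
  + by rewrite /der scaler0; apply: span_zero.
  + by move=> x y gx gy; rewrite derD; apply: tensor_gr_add.
  move=> j k a b ga gb <-; rewrite /der -tensZl; apply: tensor_gr_tens => //.
  exact: gr_scale.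
- move: t; apply: tensor_homogeneous_ind.
  + by exists 0, 0; split; [apply: span_zero..|rewrite addr0].
  + move=> s t [s0 [s1 [gs0 gs1 ->]]] [t0 [t1 [gt0 gt1 ->]]].
    by exists (s0 + t0), (s1 + t1); split; [apply: tensor_gr_add..|rewrite addrACA].
  move=> j k a b ga gb; have := tensor_gr_tens ga gb; case: (j (+) k) => gt.
    by exists 0, (tens a b); split; [apply: span_zero| |rewrite add0r].
  by exists (tens a b), 0; split; [|apply: span_zero|rewrite addr0].
(* The odd projection kills [t] as an even tensor and fixes it as an odd one. *)
have := tensor_proj_gr true g0; rewrite /= => <-.
by rewrite (tensor_proj_gr true g1).
Qed.

Lemma tensor_biadditive_ext (V : zmodType) (f g : L -> L -> V) :
  biadditive f -> biadditive g ->
  (forall i1 i2 j1 j2 a1 a2 b1 b2, gr1 i1 a1 -> gr2 i2 a2 -> gr1 j1 b1 ->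
     gr2 j2 b2 -> f (tens a1 a2) (tens b1 b2) = g (tens a1 a2) (tens b1 b2)) ->
  forall s t, f s t = g s t.
Proof.
move=> [fl fr] [gl gr] fg.
apply: tensor_homogeneous_ind => [t|s s' IH IH' t|i1 i2 a1 a2 g1 g2].
- by rewrite (addm0 (fl t)) (addm0 (gl t)).
- by rewrite fl gl IH IH'.
apply: tensor_homogeneous_ind => [|t t' IH IH'|j1 j2 b1 b2 g3 g4].
- by rewrite (addm0 (fr _)) (addm0 (gr _)).
- by rewrite fr gr IH IH'.
exact: fg g1 g2 g3 g4.
Qed.

(** The parities of the first two arguments are tracked because the sign of exchanging them occurs
    in the identities to be proved. *)
Lemma tensor_triadditive_ext (V : zmodType) (f g : L -> L -> L -> V) i j :
  triadditive f -> triadditive g ->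
  (forall i1 i2 j1 j2 k1 k2 a1 a2 b1 b2 c1 c2, gr1 i1 a1 -> gr2 i2 a2 ->
     gr1 j1 b1 -> gr2 j2 b2 -> gr1 k1 c1 -> gr2 k2 c2 ->
     i1 (+) i2 = i -> j1 (+) j2 = j ->
     f (tens a1 a2) (tens b1 b2) (tens c1 c2)
     = g (tens a1 a2) (tens b1 b2) (tens c1 c2)) ->
  forall s t u, grT i s -> grT j t -> f s t u = g s t u.
Proof.
move=> [fa fb fc] [ga gb gc] fg s t u gs gt; move: t gt u; move: s gs.
apply: tensor_gr_ind => [t gt u|s s' IH IH' t gt u|i1 i2 a1 a2 g1 g2 ei].
- by rewrite (addm0 (fa t u)) (addm0 (ga t u)).
- by rewrite fa ga IH // IH'.
apply: tensor_gr_ind => [u|t t' IH IH' u|j1 j2 b1 b2 g3 g4 ej].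
- by rewrite (addm0 (fb _ u)) (addm0 (gb _ u)).
- by rewrite fb gb IH IH'.
apply: tensor_homogeneous_ind => [|u u' IH IH'|k1 k2 c1 c2 g5 g6].
- by rewrite (addm0 (fc _ _)) (addm0 (gc _ _)).
- by rewrite fc gc IH IH'.
exact: fg g1 g2 g3 g4 g5 g6 ei ej.
Qed.

End TensorGrading.

(** * Products on the tensor product *)

Section BilinearProduct.
Variables (C : fieldType) (K : lmodType {poly C}) (op : K -> K -> lpoly K).

Lemma c_bilinearZl c a b :
  c_bilinear op -> op (c%:P *: a) b = cscale c (op a b).
Proof.
move=> opB; have [l _] := opB; have [opl _] := c_bilinear_biadditive opB.
by rewrite -[c%:P *: a]addr0 l (addm0 (opl b)) addr0.
Qed.

Lemma c_bilinearZr c a b :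
  c_bilinear op -> op a (c%:P *: b) = cscale c (op a b).
Proof.
move=> opB; have [_ r] := opB; have [_ opr] := c_bilinear_biadditive opB.
by rewrite -[c%:P *: b]addr0 r (addm0 (opr a)) addr0.
Qed.

Lemma op_opp_biadditive :
  biadditive op -> biadditive (fun a b => op_opp op b a).
Proof.
move=> [opl opr]; have SD := subst_lamD (@opp_shiftD C K) (@const1D K).
by split=> u x y; rewrite /op_opp ?opl ?opr SD.
Qed.

End BilinearProduct.

Section TensProd.
Variables (C : fieldType) (L1 L2 : lmodType {poly C}).
Variables (gr1 : bool -> L1 -> Prop) (gr2 : bool -> L2 -> Prop).
Hypotheses (gr1P : z2_graded gr1) (gr2P : z2_graded gr2).

Local Notation L := (tensor L1 L2).
Local Notation grT := (tensor_gr gr1 gr2).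

Lemma tens_lam_biadditive : biadditive (@tens_lam C L1 L2).
Proof. exact: (@tens_malg_biadditive _ L1 L2 nat addn). Qed.

Lemma tens_lam_parity j k p q : (forall n, gr1 j p@_n) -> (forall n, gr2 k q@_n) ->
  forall n, grT (j (+) k) (tens_lam p q)@_n.
Proof.
move=> gp gq n.
have grS (I : Type) (r : seq I) (F : I -> L) : (forall i, grT (j (+) k) (F i)) ->
    grT (j (+) k) (\sum_(i <- r) F i).
  move=> gF; apply: big_ind => //; first exact: span_zero.
  exact: tensor_gr_add.
rewrite /tens_lam (addm_sum (mcoeffD n)); apply: (grS) => m1.
rewrite (addm_sum (mcoeffD n)); apply: (grS) => m2; rewrite mcoeffU.
by case: eqP => _; [apply: tensor_gr_tens|apply: span_zero].
Qed.

Local Opaque tens_lam coef_map exp_map subst_lam gr_proj.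

Let tlDl := tens_lam_biadditive.1.
Let tlDr := tens_lam_biadditive.2.

Lemma derT_l (a : L1) (b : L2) : der (tens a b) = tens (der a) b.
Proof. by rewrite /der tensZl. Qed.

Lemma derT_r (a : L1) (b : L2) : der (tens a b) = tens a (der b).
Proof. by rewrite /der tensZr. Qed.

Lemma tens_lam_derl p q :
  coef_map (@der C L) (tens_lam p q) = tens_lam (coef_map (@der C L1) p) q.
Proof. apply: (tens_malg_coef_mapl addn); [exact: derD..|exact: derT_l]. Qed.

Lemma tens_lam_derr p q :
  coef_map (@der C L) (tens_lam p q) = tens_lam p (coef_map (@der C L2) q).
Proof. apply: (tens_malg_coef_mapr addn); [exact: derD..|exact: derT_r]. Qed.

Lemma tens_lam_cscalel c p q :
  cscale c (tens_lam p q) = tens_lam (cscale c p) q :> lpoly L.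
Proof.
by apply: (tens_malg_coef_mapl addn) => [x y|x y|a b]; rewrite ?scalerDr ?tensZl.
Qed.

Lemma tens_lam_cscaler c p q :
  cscale c (tens_lam p q) = tens_lam p (cscale c q) :> lpoly L.
Proof.
by apply: (tens_malg_coef_mapr addn) => [x y|x y|a b]; rewrite ?scalerDr ?tensZr.
Qed.

Lemma tens_lam_mull p q : mul_lam1 (tens_lam p q) = tens_lam (mul_lam1 p) q :> lpoly L.
Proof. by apply: (tens_malg_exp_mapl (op := addn)) => m n; rewrite addSn. Qed.

Lemma tens_lam_mulr p q : mul_lam1 (tens_lam p q) = tens_lam p (mul_lam1 q) :> lpoly L.
Proof. by apply: (tens_malg_exp_mapr (op := addn)) => m n; rewrite addnS. Qed.

(** The parity automorphism, multiplying a homogeneous [a] by (-1)^|a|, but defined on all elements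
    and C[d]-linear. *)
Definition gr_sign (a : L2) : L2 := gr_proj gr2P false a - gr_proj gr2P true a.

Lemma gr_signD : additive_map gr_sign.
Proof. by move=> a b; rewrite /gr_sign !gr_projD opprD addrACA. Qed.

Lemma gr_signZ p a : gr_sign (p *: a) = p *: gr_sign a.
Proof. by rewrite /gr_sign !gr_projZ scalerBr. Qed.

Lemma gr_signE i a : gr2 i a -> gr_sign a = sgn i a.
Proof.
move=> ga; have [p q] := gr_proj_id gr2P ga; rewrite /gr_sign.
by case: i ga p q => _ /= -> ->; rewrite ?subr0 ?sub0r.
Qed.

Section Product.
Variables (o1 : L1 -> L1 -> lpoly L1) (o2 : L2 -> L2 -> lpoly L2).
Hypotheses (o1C : conformal_superalgebra gr1 o1).
Hypotheses (o2C : conformal_superalgebra gr2 o2).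

Let o1l := (c_bilinear_biadditive (cs_bilinear o1C)).1.
Let o1r := (c_bilinear_biadditive (cs_bilinear o1C)).2.
Let o2l := (c_bilinear_biadditive (cs_bilinear o2C)).1.
Let o2r := (c_bilinear_biadditive (cs_bilinear o2C)).2.

(** By induction on [p] only the action of ['X] matters. In both factors it becomes d + lambda, and
    d and lambda each pass from one side of [tens_lam] to the other; for [tens_lam_balancedl] the
    common operator is - lambda. *)
Lemma tens_lam_balancedr p a1 b1 a2 b2 :
  tens_lam (o1 a1 (p *: b1)) (o2 a2 b2) = tens_lam (o1 a1 b1) (o2 a2 (p *: b2)).
Proof.
elim/poly_ind: p b1 b2 => [|p c IH] b1 b2.
  rewrite !scale0r (addm0 (o1r a1)) (addm0 (o2r a2)).
  by rewrite (addm0 (tlDl _)) (addm0 (tlDr _)).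
rewrite !scalerDl (o1r a1) (o2r a2) tlDl tlDr.
apply: (congr2 +%R); last first.
  rewrite (c_bilinearZr _ _ _ (cs_bilinear o1C)).
  by rewrite (c_bilinearZr _ _ _ (cs_bilinear o2C)) -tens_lam_cscalel tens_lam_cscaler.
rewrite -scalerA IH mulrC -scalerA (cs_derr o1C a1) (cs_derr o2C a2) tlDl tlDr.
by rewrite -tens_lam_derl -tens_lam_derr -tens_lam_mull -tens_lam_mulr.
Qed.

Lemma tens_lam_balancedl p a1 b1 a2 b2 :
  tens_lam (o1 (p *: a1) b1) (o2 a2 b2) = tens_lam (o1 a1 b1) (o2 (p *: a2) b2).
Proof.
elim/poly_ind: p a1 a2 => [|p c IH] a1 a2.
  rewrite !scale0r (addm0 (o1l b1)) (addm0 (o2l b2)).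
  by rewrite (addm0 (tlDl _)) (addm0 (tlDr _)).
rewrite !scalerDl (o1l b1) (o2l b2) tlDl tlDr.
apply: (congr2 +%R); last first.
  rewrite (c_bilinearZl _ _ _ (cs_bilinear o1C)).
  by rewrite (c_bilinearZl _ _ _ (cs_bilinear o2C)) -tens_lam_cscalel tens_lam_cscaler.
rewrite -scalerA IH mulrC -scalerA (cs_derl o1C a1) (cs_derl o2C).
by rewrite (addmN (tlDl _)) (addmN (tlDr _)) -tens_lam_mull -tens_lam_mulr.
Qed.

(* The Koszul sign (-1)^(|a2| |b1|) is produced by splitting b1 into its
   homogeneous components, the odd one seeing the parity operator on a2. *)
Definition tens_prod_pure a1 a2 b1 b2 : lpoly L :=
  tens_lam (o1 a1 (gr_proj gr1P false b1)) (o2 a2 b2)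
  + tens_lam (o1 a1 (gr_proj gr1P true b1)) (o2 (gr_sign a2) b2).

Definition tens_prod (s t : L) : lpoly L :=
  tensor_lift (fun a1 a2 => tensor_lift (tens_prod_pure a1 a2) t) s.

Lemma tens_prod_balancedr a1 a2 : balanced (tens_prod_pure a1 a2).
Proof.
split; first split=> u x y.
- by rewrite /tens_prod_pure !gr_projD !(o1r a1) !tlDl; exact: addrACA.
- by rewrite /tens_prod_pure !o2r !tlDr; exact: addrACA.
by move=> p m n; rewrite /tens_prod_pure !gr_projZ !tens_lam_balancedr.
Qed.

Lemma tens_prod_balancedl t :
  balanced (fun a1 a2 => tensor_lift (tens_prod_pure a1 a2) t).
Proof.
split; first split=> u x y.
- apply: tensor_lift_add => m n; rewrite /tens_prod_pure.
  by rewrite !(o1l _ x) !tlDl; exact: addrACA.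
- apply: tensor_lift_add => m n; rewrite /tens_prod_pure.
  by rewrite gr_signD !(o2l n) !tlDr; exact: addrACA.
move=> p m n; apply: eq_tensor_lift => k l; rewrite /tens_prod_pure gr_signZ.
by rewrite !tens_lam_balancedl.
Qed.

Lemma tens_prod_biadditive : biadditive tens_prod.
Proof.
split=> [t|s] x y; first exact: (tensor_liftD (tens_prod_balancedl t)).
apply: tensor_lift_add => a1 a2.
exact: tensor_liftD (tens_prod_balancedr a1 a2) _ _.
Qed.

Lemma tens_prodE i j a1 a2 b1 b2 : gr2 i a2 -> gr1 j b1 ->
  tens_prod (tens a1 a2) (tens b1 b2) = sgn (i && j) (tens_lam (o1 a1 b1) (o2 a2 b2)).
Proof.
move=> ga gb; rewrite /tens_prod (tensor_liftE _ _ (tens_prod_balancedl _)).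
rewrite (tensor_liftE _ _ (tens_prod_balancedr _ _)) /tens_prod_pure.
rewrite (gr_signE ga) (addm_sgn _ _ (o2l b2)) (addm_sgn _ _ (tlDr _)).
have [p q] := gr_proj_id gr1P gb.
case: j gb p q => _ /= -> ->; rewrite (addm0 (o1r a1)) !(addm0 (tlDl _)).
  by rewrite add0r andbT.
by rewrite andbF (addm0 (@sgnD _ i)) addr0.
Qed.

Let tpl := tens_prod_biadditive.1.
Let tpr := tens_prod_biadditive.2.

Lemma tens_prod_c_bilinear : c_bilinear tens_prod.
Proof.
have [tpl' tpr'] := tens_prod_biadditive.
have scD (c : C) : additive_map (fun t : L => c%:P *: t).
  by move=> x y; rewrite scalerDr.
split=> c s s' t.
  rewrite (tpl t); apply: (congr2 +%R); last by []; move: s t.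
  apply: (tensor_biadditive_ext (gr1 := gr1) (gr2 := gr2) gr1P gr2P
    (f := fun s t => tens_prod (c%:P *: s) t)
    (g := fun s t => cscale c (tens_prod s t))) => [||i1 i2 j1 j2 a1 a2 b1 b2 g1 g2 g3 g4].
  - by split=> u x y /=; rewrite ?scalerDr ?tpl ?tpr.
  - by split=> u x y /=; rewrite ?tpl ?tpr cscaleD.
  rewrite -tensZl !(tens_prodE _ _ g2 g3) (addm_sgn _ _ (@cscaleD _ _ c)).
  by rewrite (c_bilinearZl _ _ _ (cs_bilinear o1C)) tens_lam_cscalel.
rewrite (tpr s); apply: (congr2 +%R); last by []; move: s s'.
apply: (tensor_biadditive_ext (gr1 := gr1) (gr2 := gr2) gr1P gr2P
  (f := fun s t => tens_prod s (c%:P *: t))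
  (g := fun s t => cscale c (tens_prod s t))) => [||i1 i2 j1 j2 a1 a2 b1 b2 g1 g2 g3 g4].
- by split=> u x y /=; rewrite ?scalerDr ?tpl ?tpr.
- by split=> u x y /=; rewrite ?tpl ?tpr cscaleD.
rewrite -tensZr !(tens_prodE _ _ g2 g3) (addm_sgn _ _ (@cscaleD _ _ c)).
by rewrite (c_bilinearZr _ _ _ (cs_bilinear o2C)) tens_lam_cscaler.
Qed.

Lemma tens_prod_conformal : conformal_superalgebra grT tens_prod.
Proof.
have gTP := tensor_graded gr1P gr2P.
split=> [//||i j s t gs gt n|s t|s t].
- exact: tens_prod_c_bilinear.
- move: t gt; move: s gs; apply: (tensor_gr_ind gr1P).
  + by move=> t gt; rewrite (addm0 (tpl t)) mcoeff0; apply: span_zero.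
  + move=> s s' IH IH' t gt; rewrite tpl mcoeffD; apply: tensor_gr_add.
      exact: IH.
    exact: IH'.
  move=> i1 i2 a1 a2 g1 g2 ei; apply: (tensor_gr_ind gr1P).
  + by rewrite (addm0 (tpr _)) mcoeff0; apply: span_zero.
  + by move=> t t' IH IH'; rewrite tpr mcoeffD; apply: tensor_gr_add.
  move=> j1 j2 b1 b2 g3 g4 ej; rewrite (tens_prodE _ _ g2 g3).
  rewrite -ei -ej addbACA (addm_sgn _ _ (mcoeffD n)).
  have gr : grT ((i1 (+) j1) (+) (i2 (+) j2)) (tens_lam (o1 a1 b1) (o2 a2 b2))@_n.
    apply: tens_lam_parity => m.
      exact: (cs_parity o1C g1 g3).
    exact: (cs_parity o2C g2 g4).
  by case: (_ && _) => //=; apply: (gr_opp gTP).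
- move: s t; apply: (tensor_biadditive_ext (gr1 := gr1) (gr2 := gr2) gr1P gr2P
    (f := fun s t => tens_prod (der s) t)
    (g := fun s t => - mul_lam1 (tens_prod s t)))
    => [||i1 i2 j1 j2 a1 a2 b1 b2 g1 g2 g3 g4].
  + by split=> u x y /=; rewrite ?derD ?tpl ?tpr.
  + by split=> u x y /=; rewrite ?tpl ?tpr mul_lam1D opprD.
  rewrite derT_l !(tens_prodE _ _ g2 g3) (addm_sgn _ _ (@mul_lam1D _)) -sgnN.
  by rewrite (cs_derl o1C) (addmN (tlDl _)) tens_lam_mull.
move: s t; apply: (tensor_biadditive_ext (gr1 := gr1) (gr2 := gr2) gr1P gr2P
  (f := fun s t => tens_prod s (der t))
  (g := fun s t => coef_map (@der C L) (tens_prod s t) + mul_lam1 (tens_prod s t)))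
  => [||i1 i2 j1 j2 a1 a2 b1 b2 g1 g2 g3 g4].
+ by split=> u x y /=; rewrite ?derD ?tpl ?tpr.
+ by split=> u x y /=; rewrite ?tpl ?tpr mul_lam1D coef_mapD 1?addrACA //; apply: derD.
rewrite derT_r !(tens_prodE _ _ g2 g3) (addm_sgn _ _ (@mul_lam1D _)).
rewrite (addm_sgn _ _ (coef_mapD (@derD C L))) -sgnD.
by rewrite (cs_derr o2C) tlDr tens_lam_derr tens_lam_mulr.
Qed.

(** The operator - d - lambda may be applied in either factor, so flipping both factors flips the
    tensor product. The product uses [e1] and [e2] both false; each half of the bracket has exactly
    one of them true and is therefore skew-symmetric by itself. *)
Lemma tens_prod_commutative e1 e2 :
  twisted_commutative e1 gr1 o1 -> twisted_commutative e2 gr2 o2 ->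
  twisted_commutative (e1 (+) e2) grT tens_prod.
Proof.
move=> c1 c2 i j s t gs gt; have SD := subst_lamD (@opp_shiftD C L) (@const1D L).
have opp0l x : op_opp tens_prod x 0 = 0.
  by rewrite (addm0 ((op_opp_biadditive tens_prod_biadditive).1 x)).
have opp0r x : op_opp tens_prod 0 x = 0.
  by rewrite (addm0 ((op_opp_biadditive tens_prod_biadditive).2 x)).
have [oppl oppr] := op_opp_biadditive tens_prod_biadditive.
move: t gt; move: s gs; apply: (tensor_gr_ind gr1P).
- by move=> t gt; rewrite (addm0 (tpl t)) opp0l (addm0 (@sgnD _ _)).
- by move=> s s' IH IH' t gt; rewrite tpl oppl sgnD IH // IH'.
move=> i1 i2 a1 a2 g1 g2 ei; apply: (tensor_gr_ind gr1P).
- by rewrite (addm0 (tpr _)) opp0r (addm0 (@sgnD _ _)).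
- by move=> t t' IH IH'; rewrite tpr oppr sgnD IH IH'.
move=> j1 j2 b1 b2 g3 g4 ej; rewrite /op_opp (tens_prodE _ _ g2 g3) (tens_prodE _ _ g4 g1).
rewrite (addm_sgn _ _ SD) (c1 _ _ _ _ g1 g3) (c2 _ _ _ _ g2 g4).
rewrite (addm_sgn _ _ (tlDl _)) (addm_sgn _ _ (tlDr _)).
rewrite (tens_lam_subst_lam (B := @tens_lam C L1 L2)
  (s1 := fun p => - coef_map (@der C L1) p - mul_lam1 p)
  (s2 := fun p => - coef_map (@der C L2) p - mul_lam1 p)
  (f1 := @const1 L1) (f2 := @const1 L2)).
- rewrite -/(op_opp o1 b1 a1) -/(op_opp o2 b2 a2) !sgn_addb -ei -ej.
  by clear; case: e1 e2 i1 i2 j1 j2 => [] [] [] [] [] [].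
- exact: opp_shiftD.
- exact: const1D.
- exact: tens_lam_biadditive.
- by move=> x y; rewrite (addmB (tlDl _)) (addmN (tlDl _)) tens_lam_derl tens_lam_mull.
- by move=> x y; rewrite (addmB (tlDr _)) (addmN (tlDr _)) tens_lam_derr tens_lam_mulr.
by move=> m n; rewrite /const1; apply/esym/(tens_malgU addn).
Qed.

End Product.
End TensProd.

(** * Nested products on the tensor product *)

Section Triadditive.
Variables (U V : zmodType).
Implicit Types f g : U -> U -> U -> V.

Lemma triadditive_add f g : triadditive f -> triadditive g ->
  triadditive (fun a b c => f a b c + g a b c).
Proof.
move=> [fa fb fc] [ga gb gc].
split=> [b c|a c|a b] x y; rewrite ?fa ?fb ?fc ?ga ?gb ?gc; exact: addrACA.
Qed.

Lemma triadditive_sgn e f : triadditive f -> triadditive (fun a b c => sgn e (f a b c)).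
Proof.
by move=> [fa fb fc]; split=> [b c|a c|a b] x y; rewrite ?fa ?fb ?fc sgnD.
Qed.

Lemma triadditive_swap f : triadditive f -> triadditive (fun a b c => f b a c).
Proof. by move=> [fa fb fc]; split=> [b c|a c|a b] x y; rewrite ?fa ?fb ?fc. Qed.

End Triadditive.

Section NestAdditive.
Variables (A : zmodType) (s t : lmpoly A -> lmpoly A).
Hypotheses (sD : additive_map s) (tD : additive_map t).
Implicit Types o p : A -> A -> lpoly A.

Let inner_addl o : biadditive o -> forall c,
  additive_map (fun d => subst_lam t (@const2 A) (o d c)).
Proof. by move=> [ol or] c x y; rewrite ol subst_lam_const2D. Qed.

Let inner_addr o : biadditive o -> forall c,
  additive_map (fun d => subst_lam s (@const2 A) (o c d)).
Proof. by move=> [ol or] c x y; rewrite or subst_lam_const2D. Qed.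

Lemma subst_lam_fun_add (u : lmpoly A -> lmpoly A) (f g h : A -> lmpoly A) q :
  additive_map u -> (forall x, h x = f x + g x) ->
  subst_lam u h q = subst_lam u f q + subst_lam u g q.
Proof.
move=> uD hfg; rewrite /subst_lam -big_split; apply: eq_bigr => n _ /=.
by rewrite hfg addm_iter.
Qed.

Lemma nest_r_triadditive o p : biadditive o -> biadditive p ->
  triadditive (nest_r s t o p).
Proof.
move=> oB pB; have [ol or] := oB; have [pl pr] := pB.
have fD a := inner_addr oB a.
split=> [b c|a c|a b] x y; rewrite /nest_r.
- by apply: subst_lam_fun_add => // d; rewrite ol subst_lam_const2D.
- by rewrite pl (subst_lamD tD (fD a)).
by rewrite pr (subst_lamD tD (fD a)).
Qed.

Lemma nest_l_triadditive o p : biadditive o -> biadditive p ->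
  triadditive (nest_l s t o p).
Proof.
move=> oB pB; have [ol or] := oB; have [pl pr] := pB.
have fD c := inner_addl pB c.
split=> [b c|a c|a b] x y; rewrite /nest_l.
- by rewrite ol (subst_lamD sD (fD c)).
- by rewrite or (subst_lamD sD (fD c)).
by apply: subst_lam_fun_add => // d; rewrite pr subst_lam_const2D.
Qed.

Lemma nest_r_addl o o' p a b c :
  nest_r s t (fun x y => o x y + o' x y) p a b c
  = nest_r s t o p a b c + nest_r s t o' p a b c.
Proof.
by apply: subst_lam_fun_add => // d; rewrite subst_lam_const2D.
Qed.

Lemma nest_r_addr o p p' a b c : biadditive o ->
  nest_r s t o (fun x y => p x y + p' x y) a b c
  = nest_r s t o p a b c + nest_r s t o p' a b c.
Proof. by move=> oB; rewrite /nest_r (subst_lamD tD (inner_addr oB a)). Qed.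

Lemma nest_l_addr o p p' a b c :
  nest_l s t o (fun x y => p x y + p' x y) a b c
  = nest_l s t o p a b c + nest_l s t o p' a b c.
Proof.
by apply: subst_lam_fun_add => // d; rewrite subst_lam_const2D.
Qed.

Lemma nest_l_addl o o' p a b c : biadditive p ->
  nest_l s t (fun x y => o x y + o' x y) p a b c
  = nest_l s t o p a b c + nest_l s t o' p a b c.
Proof. by move=> pB; rewrite /nest_l (subst_lamD sD (inner_addl pB c)). Qed.

Lemma nest_r_add o o' p p' a b c : biadditive o -> biadditive o' ->
  nest_r s t (fun x y => o x y + o' x y) (fun x y => p x y + p' x y) a b c
  = nest_r s t o p a b c + nest_r s t o p' a b c
    + (nest_r s t o' p a b c + nest_r s t o' p' a b c).
Proof. by move=> oB o'B; rewrite nest_r_addl !nest_r_addr. Qed.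

Lemma nest_l_add o o' p p' a b c : biadditive p -> biadditive p' ->
  nest_l s t (fun x y => o x y + o' x y) (fun x y => p x y + p' x y) a b c
  = nest_l s t o p a b c + nest_l s t o p' a b c
    + (nest_l s t o' p a b c + nest_l s t o' p' a b c).
Proof.
move=> pB p'B; rewrite nest_l_addr (nest_l_addl _ _ _ _ _ pB).
by rewrite (nest_l_addl _ _ _ _ _ p'B); apply: addrACA.
Qed.

End NestAdditive.

Section TensNest.
Variables (C : fieldType) (L1 L2 : lmodType {poly C}).
Variables (gr1 : bool -> L1 -> Prop) (gr2 : bool -> L2 -> Prop).
Hypotheses (gr1P : z2_graded gr1) (gr2P : z2_graded gr2).

Local Notation L := (tensor L1 L2).

Definition tens_lmpoly : lmpoly L1 -> lmpoly L2 -> lmpoly L :=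
  tens_malg (fun e e' => (e.1 + e'.1, e.2 + e'.2)%N).

Lemma tens_lmpoly_biadditive : biadditive tens_lmpoly.
Proof. exact: tens_malg_biadditive. Qed.

Let tDl := tens_lmpoly_biadditive.1.
Let tDr := tens_lmpoly_biadditive.2.

(** Multiplication by a variable can be carried out in either factor but not in both at once, hence
    two separate equations. *)
Definition tens_stable (s : lmpoly L -> lmpoly L) (s1 : lmpoly L1 -> lmpoly L1)
    (s2 : lmpoly L2 -> lmpoly L2) : Prop :=
  [/\ additive_map s, forall p q, s (tens_lmpoly p q) = tens_lmpoly (s1 p) q
    & forall p q, s (tens_lmpoly p q) = tens_lmpoly p (s2 q)].

Lemma tens_stable_lam : tens_stable (@mul_lam L) (@mul_lam L1) (@mul_lam L2).
Proof.
split=> [|p q|p q]; first exact: mul_lamD.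
  by apply: tens_malg_exp_mapl => m n; rewrite addSn.
by apply: tens_malg_exp_mapr => m n; rewrite addnS.
Qed.

Lemma tens_stable_mu : tens_stable (@mul_mu L) (@mul_mu L1) (@mul_mu L2).
Proof.
split=> [|p q|p q]; first exact: mul_muD.
  by apply: tens_malg_exp_mapl => m n; rewrite addSn.
by apply: tens_malg_exp_mapr => m n; rewrite addnS.
Qed.

Lemma tens_stable_lam_mu :
  tens_stable (@mul_lam_mu L) (@mul_lam_mu L1) (@mul_lam_mu L2).
Proof.
have [_ l1 l2] := tens_stable_lam; have [_ m1 m2] := tens_stable_mu.
split=> [|p q|p q]; first exact: mul_lam_muD.
  by rewrite /mul_lam_mu l1 m1 tDl.
by rewrite /mul_lam_mu l2 m2 tDr.
Qed.

Lemma tens_lmpoly_const2 a b :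
  const2 (tens a b) = tens_lmpoly (const2 a) (const2 b).
Proof. by rewrite /tens_lmpoly /const2 tens_malgU. Qed.

Lemma tens_lam_subst_const2 s s1 s2 p q : tens_stable s s1 s2 ->
  subst_lam s (@const2 L) (tens_lam p q)
  = tens_lmpoly (subst_lam s1 (@const2 L1) p) (subst_lam s2 (@const2 L2) q).
Proof.
move=> [sD s_1 s_2].
apply: (tens_lam_subst_lam sD (@const2D L) tens_lmpoly_biadditive s_1 s_2) => m n.
exact: tens_lmpoly_const2.
Qed.

Lemma tens_lmpoly_sgn e :
  biadditive (fun x y => sgn e (tens_lmpoly x y)).
Proof. by split=> u x y /=; rewrite ?tDl ?tDr sgnD. Qed.

Section Product.
Variables o1 p1 : L1 -> L1 -> lpoly L1.
Variables o2 p2 : L2 -> L2 -> lpoly L2.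
Hypotheses (o1C : conformal_superalgebra gr1 o1) (p1C : conformal_superalgebra gr1 p1).
Hypotheses (o2C : conformal_superalgebra gr2 o2) (p2C : conformal_superalgebra gr2 p2).
Variables (s t : lmpoly L -> lmpoly L) (s1 t1 : lmpoly L1 -> lmpoly L1).
Variables (s2 t2 : lmpoly L2 -> lmpoly L2).
Hypotheses (ss : tens_stable s s1 s2) (tt : tens_stable t t1 t2).
Variables (i1 i2 j1 j2 k1 k2 : bool).
Variables (a1 b1 c1 : L1) (a2 b2 c2 : L2).
Hypotheses (ga1 : gr1 i1 a1) (gb1 : gr1 j1 b1) (gc1 : gr1 k1 c1).
Hypotheses (ga2 : gr2 i2 a2) (gb2 : gr2 j2 b2) (gc2 : gr2 k2 c2).

Local Notation o := (tens_prod gr1P gr2P o1 o2).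
Local Notation p := (tens_prod gr1P gr2P p1 p2).

(* The sign of moving a2 past b1 c1 and b2 past c1. *)
Definition koszul3 (i2 j1 j2 k1 : bool) : bool :=
  (i2 && j1) (+) (i2 && k1) (+) (j2 && k1).

Lemma nest_r_tens :
  nest_r s t o p (tens a1 a2) (tens b1 b2) (tens c1 c2)
  = sgn (koszul3 i2 j1 j2 k1)
      (tens_lmpoly (nest_r s1 t1 o1 p1 a1 b1 c1) (nest_r s2 t2 o2 p2 a2 b2 c2)).
Proof.
have [sD _ _] := ss; have [tD t_1 t_2] := tt.
have [_ or] := tens_prod_biadditive gr1P gr2P o1C o2C.
have fD : additive_map
    (fun d => subst_lam s (@const2 L) (o (tens a1 a2) d)).
  by move=> x y; rewrite or subst_lam_const2D.
rewrite /nest_r (tens_prodE _ _ p1C p2C _ _ gb2 gc1) (addm_sgn _ _ (subst_lamD tD fD)).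
(* The sign in [B] comes from the outer product: [a2] passes the coefficients of [p1 b1 c1], all of
   parity [j1 (+) k1]. *)
rewrite (tens_lam_subst_lam
  (B := fun x y => sgn (i2 && (j1 (+) k1)) (tens_lmpoly x y))
  (s1 := t1) (s2 := t2)
  (f1 := fun d => subst_lam s1 (@const2 L1) (o1 a1 d))
  (f2 := fun d => subst_lam s2 (@const2 L2) (o2 a2 d)) tD fD (tens_lmpoly_sgn _)).
- rewrite sgn_addb /koszul3; congr (sgn _ _).
  by clear; case: i2 j1 k1 j2 => [] [] [] [].
- by move=> x y; rewrite (addm_sgn _ _ tD) t_1.
- by move=> x y; rewrite (addm_sgn _ _ tD) t_2.
move=> m n.
rewrite (tens_prodE _ _ o1C o2C _ _ ga2 (cs_parity p1C gb1 gc1 m)).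
rewrite (addm_sgn _ _ (subst_lam_const2D sD)); congr (sgn _ _).
exact: tens_lam_subst_const2.
Qed.

Lemma nest_l_tens :
  nest_l s t o p (tens a1 a2) (tens b1 b2) (tens c1 c2)
  = sgn (koszul3 i2 j1 j2 k1)
      (tens_lmpoly (nest_l s1 t1 o1 p1 a1 b1 c1) (nest_l s2 t2 o2 p2 a2 b2 c2)).
Proof.
have [sD s_1 s_2] := ss; have [tD t_1 t_2] := tt.
have [pl _] := tens_prod_biadditive gr1P gr2P p1C p2C.
have fD : additive_map
    (fun d => subst_lam t (@const2 L) (p d (tens c1 c2))).
  by move=> x y; rewrite pl subst_lam_const2D.
rewrite /nest_l (tens_prodE _ _ o1C o2C _ _ ga2 gb1) (addm_sgn _ _ (subst_lamD sD fD)).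
(* Here the coefficients of [o2 a2 b2], of parity [i2 (+) j2], pass [c1]. *)
rewrite (tens_lam_subst_lam
  (B := fun x y => sgn ((i2 (+) j2) && k1) (tens_lmpoly x y))
  (s1 := s1) (s2 := s2)
  (f1 := fun d => subst_lam t1 (@const2 L1) (p1 d c1))
  (f2 := fun d => subst_lam t2 (@const2 L2) (p2 d c2)) sD fD (tens_lmpoly_sgn _)).
- rewrite sgn_addb /koszul3; congr (sgn _ _).
  by clear; case: i2 j1 k1 j2 => [] [] [] [].
- by move=> x y; rewrite (addm_sgn _ _ sD) s_1.
- by move=> x y; rewrite (addm_sgn _ _ sD) s_2.
move=> m n.
rewrite (tens_prodE _ _ p1C p2C _ _ (cs_parity o2C ga2 gb2 n) gc1).
rewrite (addm_sgn _ _ (subst_lam_const2D tD)); congr (sgn _ _).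
exact: tens_lam_subst_const2.
Qed.

End Product.
End TensNest.

(** * The tensor product of two transposed Poisson conformal superalgebras *)

Section ConformalSum.
Variables (C : fieldType) (A : lmodType {poly C}) (gr : bool -> A -> Prop).
Implicit Types o p : A -> A -> lpoly A.

Lemma conformal_superalgebra_add o p :
  conformal_superalgebra gr o -> conformal_superalgebra gr p ->
  conformal_superalgebra gr (fun a b => o a b + p a b).
Proof.
move=> oC pC; have [ol or] := cs_bilinear oC; have [pl pr] := cs_bilinear pC.
split=> [|||a b|a b]; first exact: cs_graded oC.
- split=> c x y z; rewrite ?ol ?pl ?or ?pr cscaleD; exact: addrACA.
- move=> i j a b ga gb n; rewrite mcoeffD; apply: (gr_add (cs_graded oC)).
    exact: (cs_parity oC).
  exact: (cs_parity pC).
- by rewrite (cs_derl oC) (cs_derl pC) mul_lam1D opprD.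
rewrite (cs_derr oC) (cs_derr pC) mul_lam1D coef_mapD; last exact: derD.
exact: addrACA.
Qed.

Lemma twisted_commutative_add e o p :
  twisted_commutative e gr o -> twisted_commutative e gr p ->
  twisted_commutative e gr (fun a b => o a b + p a b).
Proof.
move=> oT pT i j a b ga gb; rewrite (oT i j a b) // (pT i j a b) //.
by rewrite /op_opp (subst_lamD (@opp_shiftD C A) (@const1D A)) sgnD.
Qed.

(** Associativity is stated for arbitrary elements; this reduces it to homogeneous ones, where
    Koszul signs make sense. *)
Lemma graded_triadditive_ext (V : zmodType) (f g : A -> A -> A -> V) :
  z2_graded gr -> triadditive f -> triadditive g ->
  (forall i j a b c, gr i a -> gr j b -> f a b c = g a b c) ->
  forall a b c, f a b c = g a b c.
Proof.
move=> grP [fa fb fc] [ga gb gc] fg a b c.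
have [a0 [a1 [ga0 ga1 ->]]] := gr_sum grP a.
have [b0 [b1 [gb0 gb1 ->]]] := gr_sum grP b.
rewrite !fa !fb !ga !gb.
by rewrite (fg _ _ _ _ _ ga0 gb0) (fg _ _ _ _ _ ga0 gb1) (fg _ _ _ _ _ ga1 gb0)
  (fg _ _ _ _ _ ga1 gb1).
Qed.

End ConformalSum.

(* With P = a.[b c], Q = [a b].c, R = b.[a c], U = [a (b.c)], V = [(a.b) c] and
   W = [b (a.c)] (up to signs), this is the vanishing of the mixed terms of the
   Jacobi identity of a tensor product. *)
Lemma mixed_jacobi_terms (V1 V2 X : zmodType) (B : V1 -> V2 -> X)
    (P1 Q1 R1 U1 T1 W1 : V1) (P2 Q2 R2 U2 T2 W2 : V2) :
  biadditive B -> (forall x : X, x *+ 2 = 0 -> x = 0) ->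
  P1 *+ 2 = T1 + W1 -> Q1 *+ 2 = U1 - W1 -> R1 *+ 2 = T1 + U1 ->
  P2 *+ 2 = T2 + W2 -> Q2 *+ 2 = U2 - W2 -> R2 *+ 2 = T2 + U2 ->
  B P1 U2 + B U1 P2 = (B Q1 T2 + B T1 Q2) + (B R1 W2 + B W1 R2).
Proof.
move=> [Bl Br] tf p1 q1 r1 p2 q2 r2.
have Bl2 x y : B (x *+ 2) y = B x y *+ 2 by rewrite (addmMn (Bl y)).
have Br2 x y : B x (y *+ 2) = B x y *+ 2 by rewrite (addmMn (Br x)).
have X2 (x y : X) : x *+ 2 = y *+ 2 -> x = y.
  by move=> e; apply/eqP; rewrite -subr_eq0; apply/eqP/tf; rewrite mulrnBl e subrr.
apply: X2; rewrite !mulrnDl -(Bl2 P1) -(Br2 U1) -(Bl2 Q1) -(Br2 T1) -(Bl2 R1).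
rewrite -(Br2 W1) p1 q1 r1 p2 q2 r2.
rewrite (addmB (Bl _)) (addmB (Br _)) !Bl !Br.
rewrite [X in _ = X + _]addrACA -opprD [X in _ = _ + X]addrACA.
rewrite (addrC (B T1 W2) (B W1 T2)) [RHS]addrA subrK.
by rewrite [RHS]addrACA [RHS]addrC.
Qed.

(** * Assembling the axioms from the two factors *)

Section KoszulSign.
Variables (V1 V2 X : zmodType) (B : V1 -> V2 -> X).
Hypothesis BB : biadditive B.
Variables (e e1 e2 k k' : bool).
Hypothesis ekk' : e (+) k' = k (+) (e1 (+) e2).

Let Bl := BB.1.
Let Br := BB.2.

(** [k] and [k'] stand for the Koszul signs of the triples (a, b, c) and (b, a, c), and [e], [e1],
    [e2] for the signs of exchanging a and b in the tensor product and in each factor. *)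
Lemma koszul_sgn x y :
  sgn e (sgn k' (B x y)) = sgn k (B (sgn e1 x) (sgn e2 y)).
Proof.
by rewrite (addm_sgn _ _ (Bl _)) (addm_sgn _ _ (Br _)) !sgn_addb ekk' addbA.
Qed.

(** [M], [N], [S] are the triple products a(bc), (ab)c, b(ac), and [P], [T], [W] the terms a.[b c],
    [(a.b) c], [b (a.c)] of compatibility. Once the triple products are identified they become a
    common factor, and what multiplies it is the compatibility identity of the other algebra. *)
Lemma koszul_compat (A1 A2 B1 B2 C1 C2 : X) (P1 T1 W1 M1 N1 S1 : V1)
    (P2 T2 W2 M2 N2 S2 : V2) :
  A1 = sgn k (B P1 M2) -> A2 = sgn k (B M1 P2) ->
  B1 = sgn k (B T1 N2) -> B2 = sgn k (B N1 T2) ->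
  C1 = sgn k' (B W1 S2) -> C2 = sgn k' (B S1 W2) ->
  M1 = N1 -> M2 = N2 -> S1 = sgn e1 M1 -> S2 = sgn e2 M2 ->
  P1 *+ 2 = T1 + sgn e1 W1 -> P2 *+ 2 = T2 + sgn e2 W2 ->
  (A1 + A2) *+ 2 = (B1 + B2) + sgn e (C1 + C2).
Proof.
move=> -> -> -> -> -> -> <- <- -> -> p1 p2.
rewrite (sgnD e) !koszul_sgn !sgnK -!sgnD -sgnMn; congr (sgn _ _).
by rewrite mulrnDl -(addmMn (Bl M2)) -(addmMn (Br M1)) p1 p2 Bl Br addrACA.
Qed.

(** [J], [K], [H] are the three terms of the Jacobi identity of a factor, paired with triple
    products of the other; the remaining letters form the mixed terms. *)
Lemma koszul_jacobi (A1 A2 A3 A4 B1 B2 B3 B4 C1 C2 C3 C4 : X)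
    (J1 K1 H1 P1 Q1 R1 U1 T1 W1 M1 N1 S1 : V1)
    (J2 K2 H2 P2 Q2 R2 U2 T2 W2 M2 N2 S2 : V2) :
  A1 = sgn k (B J1 M2) -> A2 = sgn k (B U1 P2) ->
  A3 = sgn k (B P1 U2) -> A4 = sgn k (B M1 J2) ->
  B1 = sgn k (B K1 N2) -> B2 = sgn k (B Q1 T2) ->
  B3 = sgn k (B T1 Q2) -> B4 = sgn k (B N1 K2) ->
  C1 = sgn k' (B H1 S2) -> C2 = sgn k' (B W1 R2) ->
  C3 = sgn k' (B R1 W2) -> C4 = sgn k' (B S1 H2) ->
  (forall x : X, x *+ 2 = 0 -> x = 0) ->
  M1 = N1 -> M2 = N2 -> S1 = sgn e1 M1 -> S2 = sgn e2 M2 ->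
  J1 = K1 + sgn e1 H1 -> J2 = K2 + sgn e2 H2 ->
  P1 *+ 2 = T1 + sgn e1 W1 -> P2 *+ 2 = T2 + sgn e2 W2 ->
  Q1 *+ 2 = U1 - sgn e1 W1 -> Q2 *+ 2 = U2 - sgn e2 W2 ->
  R1 *+ 2 = sgn e1 (T1 + U1) -> R2 *+ 2 = sgn e2 (T2 + U2) ->
  A1 + A2 + (A3 + A4) = B1 + B2 + (B3 + B4) + sgn e (C1 + C2 + (C3 + C4)).
Proof.
move=> -> -> -> -> -> -> -> -> -> -> -> -> tf <- <- -> -> -> ->.
move=> p1 p2 q1 q2 r1 r2.
rewrite !(sgnD e) !koszul_sgn !sgnK -!sgnD; congr (sgn _ _).
(* The sign of exchanging a and b is absorbed into [R] and [W], which brings the relations to the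
   form without signs. *)
have r1' : sgn e1 R1 *+ 2 = T1 + U1 by rewrite -sgnMn r1 sgnK.
have r2' : sgn e2 R2 *+ 2 = T2 + U2 by rewrite -sgnMn r2 sgnK.
have mixed := mixed_jacobi_terms BB tf p1 q1 r1' p2 q2 r2'.
(* Summands 1, 2 and 5, 6 belong to the Jacobi identities of the two factors; 4 and 3 are the mixed
   pair. *)
rewrite (Bl M2) (Br M1) [LHS](AC (3*(1*2)) ((1*2*5*6)*(4*3))) /= mixed.
by rewrite [RHS](AC ((2*2)*(2*2)) ((1*5*4*8)*((2*3)*(7*6)))).
Qed.

End KoszulSign.

Section TensorTPCSA.
Variables (C : fieldType) (L1 L2 : lmodType {poly C}).
Hypothesis two_neq0 : (2%:R : C) != 0.
Variables (gr1 : bool -> L1 -> Prop) (mul1 br1 : L1 -> L1 -> lpoly L1).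
Variables (gr2 : bool -> L2 -> Prop) (mul2 br2 : L2 -> L2 -> lpoly L2).
Hypotheses (tp1 : tpcsa gr1 mul1 br1) (tp2 : tpcsa gr2 mul2 br2).

Local Notation L := (tensor L1 L2).
Local Notation grT := (tensor_gr gr1 gr2).
Local Notation lam := (@mul_lam L).
Local Notation mu := (@mul_mu L).
Local Notation lam_mu := (@mul_lam_mu L).

Lemma lmpoly_mul2_eq0 (A : lmodType {poly C}) (x : lmpoly A) : x *+ 2 = 0 -> x = 0.
Proof.
move=> x2; apply/malgP => k; rewrite mcoeff0.
have /(congr1 (fun p => p@_k)) := x2; rewrite mcoeffMn mcoeff0 => e.
have : (2^-1%:P * 2%:R : {poly C}) *: x@_k = 0.
  by rewrite -scalerA scaler_nat e scaler0.
by rewrite -polyC_natr -polyCM mulVf // polyC1 scale1r.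
Qed.

Let mul1C : conformal_superalgebra gr1 mul1 := tpcsa_conformal tp1.
Let mul2C : conformal_superalgebra gr2 mul2 := tpcsa_conformal tp2.
Let br1C : conformal_superalgebra gr1 br1 := lcs_conformal (tpcsa_lie tp1).
Let br2C : conformal_superalgebra gr2 br2 := lcs_conformal (tpcsa_lie tp2).
Let gr1P : z2_graded gr1 := cs_graded mul1C.
Let gr2P : z2_graded gr2 := cs_graded mul2C.

Definition tensor_mul : L -> L -> lpoly L := tens_prod gr1P gr2P mul1 mul2.

Local Notation brl := (tens_prod gr1P gr2P br1 mul2).
Local Notation brr := (tens_prod gr1P gr2P mul1 br2).

(** Each summand is a [tens_prod], so the conformal axioms and skew-symmetry hold summand by
    summand; the two interact only in the Jacobi identity. *)
Definition tensor_br (s t : L) : lpoly L := brl s t + brr s t.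

Let mulB : biadditive tensor_mul := tens_prod_biadditive gr1P gr2P mul1C mul2C.
Let brlB : biadditive brl := tens_prod_biadditive gr1P gr2P br1C mul2C.
Let brrB : biadditive brr := tens_prod_biadditive gr1P gr2P mul1C br2C.

Lemma tensor_br_biadditive : biadditive tensor_br.
Proof.
have [ll lr] := brlB; have [rl rr] := brrB.
split=> u x y; rewrite /tensor_br.
  by rewrite (ll u) (rl u) [LHS]addrACA.
by rewrite (lr u) (rr u) [LHS]addrACA.
Qed.

Lemma tensor_mul_unique : unique (is_tensor_mul gr1 gr2 mul1 mul2) tensor_mul.
Proof.
split=> [|mul' [mulC mulE]].
  split; first exact: tens_prod_c_bilinear.
  by move=> i j a1 a2 b1 b2 g2 g1; rewrite /tensor_mul (tens_prodE _ _ mul1C mul2C _ _ g2 g1).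
apply/funext => s; apply/funext => t.
apply: (tensor_biadditive_ext gr1P gr2P mulB (c_bilinear_biadditive mulC)).
move=> i1 i2 j1 j2 a1 a2 b1 b2 g1 g2 g3 g4.
by rewrite (mulE _ _ _ _ _ _ g2 g3) /tensor_mul (tens_prodE _ _ mul1C mul2C _ _ g2 g3).
Qed.

Lemma tensor_brE i j a1 a2 b1 b2 : gr2 i a2 -> gr1 j b1 ->
  tensor_br (tens a1 a2) (tens b1 b2)
  = ksign i j (tens_lam (br1 a1 b1) (mul2 a2 b2) + tens_lam (mul1 a1 b1) (br2 a2 b2)).
Proof.
move=> g2 g1; rewrite /tensor_br (tens_prodE _ _ br1C mul2C _ _ g2 g1).
by rewrite (tens_prodE _ _ mul1C br2C _ _ g2 g1) -sgnD.
Qed.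

Lemma tensor_mul_conformal : conformal_superalgebra grT tensor_mul.
Proof. exact: tens_prod_conformal. Qed.

Lemma tensor_br_conformal : conformal_superalgebra grT tensor_br.
Proof. by apply: conformal_superalgebra_add; apply: tens_prod_conformal. Qed.

Lemma tensor_br_unique :
  unique (is_tensor_br gr1 gr2 mul1 br1 mul2 br2) tensor_br.
Proof.
split=> [|br' [brC brE]].
  split; first exact: (cs_bilinear tensor_br_conformal).
  by move=> i j a1 a2 b1 b2 g2 g1; rewrite (tensor_brE _ _ g2 g1).
apply/funext => s; apply/funext => t.
apply: (tensor_biadditive_ext gr1P gr2P tensor_br_biadditive (c_bilinear_biadditive brC)).
move=> i1 i2 j1 j2 a1 a2 b1 b2 g1 g2 g3 g4.
by rewrite (brE _ _ _ _ _ _ g2 g3) (tensor_brE _ _ g2 g3).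
Qed.

Lemma tensor_mul_twisted : twisted_commutative false grT tensor_mul.
Proof.
by have := tens_prod_commutative gr1P gr2P mul1C mul2C (tpcsa_mul_twisted tp1)
  (tpcsa_mul_twisted tp2).
Qed.

Lemma tensor_br_twisted : twisted_commutative true grT tensor_br.
Proof.
apply: twisted_commutative_add.
  by have := tens_prod_commutative gr1P gr2P br1C mul2C (tpcsa_br_twisted tp1)
    (tpcsa_mul_twisted tp2).
by have := tens_prod_commutative gr1P gr2P mul1C br2C (tpcsa_mul_twisted tp1)
  (tpcsa_br_twisted tp2).
Qed.

Let lamD := @mul_lamD L.
Let muD := @mul_muD L.
Let lmD := @mul_lam_muD L.
Let stl := @tens_stable_lam C L1 L2.
Let stm := @tens_stable_mu C L1 L2.
Let stlm := @tens_stable_lam_mu C L1 L2.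
Let brB := tensor_br_biadditive.

Lemma tensor_associative : conformal_associative tensor_mul.
Proof.
apply: (graded_triadditive_ext (tensor_graded gr1P gr2P)).
- exact: (nest_r_triadditive lamD muD mulB mulB).
- exact: (nest_l_triadditive lamD lmD mulB mulB).
move=> i j s t u.
apply: (tensor_triadditive_ext gr1P gr2P).
- exact: (nest_r_triadditive lamD muD mulB mulB).
- exact: (nest_l_triadditive lamD lmD mulB mulB).
move=> i1 i2 j1 j2 k1 k2 a1 a2 b1 b2 c1 c2 ga1 ga2 gb1 gb2 gc1 gc2 _ _.
rewrite (nest_r_tens gr1P gr2P mul1C mul1C mul2C mul2C stl stm a1 c2 gb1 gc1 ga2 gb2).
rewrite (nest_l_tens gr1P gr2P mul1C mul1C mul2C mul2C stl stlm a1 c2 gb1 gc1 ga2 gb2).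
by rewrite (tpcsa_associative tp1) (tpcsa_associative tp2).
Qed.

(** Two ways to reorder a1 a2 b1 b2 c1 c2 into b1 a1 c1 b2 a2 c2: exchange the two tensors and then
    separate the factors, or separate the factors and then exchange within each. *)
Lemma koszul3_swap i1 i2 j1 j2 k1 :
  ((i1 (+) i2) && (j1 (+) j2)) (+) koszul3 j2 i1 i2 k1
  = koszul3 i2 j1 j2 k1 (+) ((i1 && j1) (+) (i2 && j2)).
Proof. by case: i1 i2 j1 j2 k1 => [] [] [] [] []. Qed.

Lemma tensor_compat i j a b c : grT i a -> grT j b ->
  nest_r lam mu tensor_mul tensor_br a b c *+ 2
  = nest_l lam lam_mu tensor_mul tensor_br a b c
    + ksign i j (nest_r mu lam tensor_br tensor_mul b a c).
Proof.
(* The double is written as a sum so that its triadditivity follows from [triadditive_add]. *)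
move=> ga gb; rewrite mulr2n; move: a b c ga gb.
apply: (tensor_triadditive_ext gr1P gr2P
  (f := fun a b c => nest_r lam mu tensor_mul tensor_br a b c
                     + nest_r lam mu tensor_mul tensor_br a b c)
  (g := fun a b c => nest_l lam lam_mu tensor_mul tensor_br a b c
     + ksign i j (nest_r mu lam tensor_br tensor_mul b a c))).
- by apply: triadditive_add; apply: (nest_r_triadditive lamD muD mulB brB).
- apply: triadditive_add; first exact: (nest_l_triadditive lamD lmD mulB brB).
  apply: (triadditive_sgn (i && j)).
  apply: (triadditive_swap (f := nest_r mu lam tensor_br tensor_mul)).
  exact: (nest_r_triadditive muD lamD brB mulB).
move=> i1 i2 j1 j2 k1 k2 a1 a2 b1 b2 c1 c2 ga1 ga2 gb1 gb2 gc1 gc2 <- <-.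
rewrite -mulr2n ksignE (nest_r_addr lamD muD brl brr _ _ _ mulB).
rewrite (nest_l_addr lamD lmD tensor_mul brl brr).
rewrite (nest_r_addl muD lamD brl brr tensor_mul).
apply: (koszul_compat (@tens_lmpoly_biadditive C L1 L2)
  (koszul3_swap i1 i2 j1 j2 k1)
  (nest_r_tens gr1P gr2P mul1C br1C mul2C mul2C stl stm a1 c2 gb1 gc1 ga2 gb2)
  (nest_r_tens gr1P gr2P mul1C mul1C mul2C br2C stl stm a1 c2 gb1 gc1 ga2 gb2)
  (nest_l_tens gr1P gr2P mul1C br1C mul2C mul2C stl stlm a1 c2 gb1 gc1 ga2 gb2)
  (nest_l_tens gr1P gr2P mul1C mul1C mul2C br2C stl stlm a1 c2 gb1 gc1 ga2 gb2)
  (nest_r_tens gr1P gr2P br1C mul1C mul2C mul2C stm stl b1 c2 ga1 gc1 gb2 ga2)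
  (nest_r_tens gr1P gr2P mul1C mul1C br2C mul2C stm stl b1 c2 ga1 gc1 gb2 ga2)).
- exact: (tpcsa_associative tp1).
- exact: (tpcsa_associative tp2).
- exact: (tpcsa_mul_swap tp1).
- exact: (tpcsa_mul_swap tp2).
- exact: (tpcsa_compat tp1).
exact: (tpcsa_compat tp2).
Qed.

Lemma tensor_jacobi i j a b c : grT i a -> grT j b ->
  nest_r lam mu tensor_br tensor_br a b c
  = nest_l lam lam_mu tensor_br tensor_br a b c
    + ksign i j (nest_r mu lam tensor_br tensor_br b a c).
Proof.
move: a b c.
apply: (tensor_triadditive_ext gr1P gr2P
  (g := fun a b c => nest_l lam lam_mu tensor_br tensor_br a b c
     + ksign i j (nest_r mu lam tensor_br tensor_br b a c))).
- exact: (nest_r_triadditive lamD muD brB brB).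
- apply: triadditive_add; first exact: (nest_l_triadditive lamD lmD brB brB).
  apply: (triadditive_sgn (i && j)).
  apply: (triadditive_swap (f := nest_r mu lam tensor_br tensor_br)).
  exact: (nest_r_triadditive muD lamD brB brB).
move=> i1 i2 j1 j2 k1 k2 a1 a2 b1 b2 c1 c2 ga1 ga2 gb1 gb2 gc1 gc2 <- <-.
rewrite ksignE (nest_r_add lamD muD brl brr _ _ _ brlB brrB).
rewrite (nest_l_add lamD lmD brl brr _ _ _ brlB brrB).
rewrite (nest_r_add muD lamD brl brr _ _ _ brlB brrB).
apply: (koszul_jacobi (@tens_lmpoly_biadditive C L1 L2)
  (koszul3_swap i1 i2 j1 j2 k1)
  (nest_r_tens gr1P gr2P br1C br1C mul2C mul2C stl stm a1 c2 gb1 gc1 ga2 gb2)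
  (nest_r_tens gr1P gr2P br1C mul1C mul2C br2C stl stm a1 c2 gb1 gc1 ga2 gb2)
  (nest_r_tens gr1P gr2P mul1C br1C br2C mul2C stl stm a1 c2 gb1 gc1 ga2 gb2)
  (nest_r_tens gr1P gr2P mul1C mul1C br2C br2C stl stm a1 c2 gb1 gc1 ga2 gb2)
  (nest_l_tens gr1P gr2P br1C br1C mul2C mul2C stl stlm a1 c2 gb1 gc1 ga2 gb2)
  (nest_l_tens gr1P gr2P br1C mul1C mul2C br2C stl stlm a1 c2 gb1 gc1 ga2 gb2)
  (nest_l_tens gr1P gr2P mul1C br1C br2C mul2C stl stlm a1 c2 gb1 gc1 ga2 gb2)
  (nest_l_tens gr1P gr2P mul1C mul1C br2C br2C stl stlm a1 c2 gb1 gc1 ga2 gb2)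
  (nest_r_tens gr1P gr2P br1C br1C mul2C mul2C stm stl b1 c2 ga1 gc1 gb2 ga2)
  (nest_r_tens gr1P gr2P br1C mul1C mul2C br2C stm stl b1 c2 ga1 gc1 gb2 ga2)
  (nest_r_tens gr1P gr2P mul1C br1C br2C mul2C stm stl b1 c2 ga1 gc1 gb2 ga2)
  (nest_r_tens gr1P gr2P mul1C mul1C br2C br2C stm stl b1 c2 ga1 gc1 gb2 ga2)).
- exact: lmpoly_mul2_eq0.
- exact: (tpcsa_associative tp1).
- exact: (tpcsa_associative tp2).
- exact: (tpcsa_mul_swap tp1).
- exact: (tpcsa_mul_swap tp2).
- exact: (lcs_jacobi (tpcsa_lie tp1)).
- exact: (lcs_jacobi (tpcsa_lie tp2)).
- exact: (tpcsa_compat tp1).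
- exact: (tpcsa_compat tp2).
- exact: (tpcsa_compat_br_mul tp1 ga1 gb1 gc1).
- exact: (tpcsa_compat_br_mul tp2 ga2 gb2 gc2).
- exact: (tpcsa_compat_swap tp1).
exact: (tpcsa_compat_swap tp2).
Qed.

Lemma tensor_tpcsa : tpcsa grT tensor_mul tensor_br.
Proof.
split.
- exact: tensor_mul_conformal.
- by move=> i j a b ga gb; rewrite (tensor_mul_twisted ga gb).
- exact: tensor_associative.
- split; first exact: tensor_br_conformal.
    move=> i j a b ga gb; rewrite (tensor_br_twisted ga gb) ksignE.
    by case: (i && j); rewrite /= ?opprK.
  exact: tensor_jacobi.
exact: tensor_compat.
Qed.

End TensorTPCSA.

Theorem theorem3p7 (R : realType) (L1 L2 : lmodType {poly complex R})
  (gr1 : bool -> L1 -> Prop) (mul1 br1 : L1 -> L1 -> lpoly L1)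
  (gr2 : bool -> L2 -> Prop) (mul2 br2 : L2 -> L2 -> lpoly L2)
  (tp1 : tpcsa gr1 mul1 br1) (tp2 : tpcsa gr2 mul2 br2) :
  exists mul br : tensor L1 L2 -> tensor L1 L2 -> lpoly (tensor L1 L2),
    [/\ unique (is_tensor_mul gr1 gr2 mul1 mul2) mul,
        unique (is_tensor_br gr1 gr2 mul1 br1 mul2 br2) br
      & tpcsa (tensor_gr gr1 gr2) mul br].
Proof.
exists (tensor_mul tp1 tp2), (tensor_br tp1 tp2); split.
- exact: tensor_mul_unique.
- exact: tensor_br_unique.
by apply: tensor_tpcsa; rewrite Num.Theory.pnatr_eq0.
Qed.
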